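(* Let $\gamma_1,\gamma_2,\gamma_3,\delta_1,\delta_2,\delta_3,x,y\in\mathbb{C}$, let $\alpha_1,\dots,\alpha_4,\beta_1,\dots,\beta_4$ be positive real numbers, and let $\operatorname{Re}p>0$. Then $$L_1\left\{t^{\delta_1-1}D_1\left(\begin{matrix}\gamma_1,\alpha_1,\beta_1;\gamma_2,\alpha_2;\gamma_3,\beta_2;\\ \delta_1,\alpha_3,\beta_3;\delta_2,\alpha_4;\delta_3,\beta_4;\end{matrix}\left|\begin{matrix}xt^{\alpha_3}\\ yt^{\beta_3}\end{matrix}\right.\right);p\right\}=\frac{1}{p^{\delta_1}}E_{11}\left(\begin{matrix}\gamma_1,\alpha_1,\beta_1;\gamma_2,\alpha_2;\gamma_3,\beta_2;\\ \delta_2,\alpha_4;\delta_3,\beta_4;\end{matrix}\left|\begin{matrix}x/p^{\alpha_3}\\ y/p^{\beta_3}\end{matrix}\right.\right).$$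
   Context: $L_1\{f(t);p\}=\int_0^\infty f(t)e^{-pt}\,dt$ is the one-dimensional Laplace transform. $(\gamma)_\lambda=\Gamma(\gamma+\lambda)/\Gamma(\gamma)$ for $\gamma\in\mathbb{C}$ and real $\lambda\ge0$. For complex $\gamma_i,\delta_i,x,y$ and positive real $\alpha_i,\beta_i$, $$D_1\left(\begin{matrix}\gamma_1,\alpha_1,\beta_1;\gamma_2,\alpha_2;\gamma_3,\beta_2;\\ \delta_1,\alpha_3,\beta_3;\delta_2,\alpha_4;\delta_3,\beta_4;\end{matrix}\left|\begin{matrix}x\\ y\end{matrix}\right.\right)=\sum_{m,n=0}^{\infty}\frac{(\gamma_1)_{\alpha_1 m+\beta_1 n}(\gamma_2)_{\alpha_2 m}(\gamma_3)_{\beta_2 n}}{\Gamma(\delta_1+\alpha_3 m+\beta_3 n)}\frac{x^m}{\Gamma(\delta_2+\alpha_4 m)}\frac{y^n}{\Gamma(\delta_3+\beta_4 n)},$$ $$E_{11}\left(\begin{matrix}\gamma_1,\alpha_1,\beta_1;\gamma_2,\alpha_2;\gamma_3,\beta_2;\\ \delta_1,\alpha_3;\delta_2,\beta_3;\end{matrix}\left|\begin{matrix}x\\ y\end{matrix}\right.\right)=\sum_{m,n=0}^{\infty}(\gamma_1)_{\alpha_1 m+\beta_1 n}(\gamma_2)_{\alpha_2 m}(\gamma_3)_{\beta_2 n}\frac{x^m}{\Gamma(\delta_1+\alpha_3 m)}\frac{y^n}{\Gamma(\delta_2+\beta_3 n)}.$$ The functions are considered at arguments in the region of absolute convergence of their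 defining series; powers of $p$ are principal.
   Formalization: Re δ1 > 0 is assumed (false for δ1 = 0), and the identity is asserted when the Laplace integral converges absolutely at p (it can diverge though E11 converges); this convergence is proved when E11 also converges absolutely with Re p in place of p. *)

(* Defs.v *)
From HB Require Import structures.
From mathcomp Require Export all_boot all_order all_algebra.
From mathcomp Require Export all_classical all_reals all_analysis.
From mathcomp Require Export complex.

Set Implicit Arguments.
Unset Strict Implicit.
Unset Printing Implicit Defensive.

Import Order.TTheory GRing.Theory Num.Theory.
Import numFieldNormedType.Exports.

Local Open Scope classical_set_scope.
Local Open Scope ring_scope.
Local Open Scope complex_scope.

Section ComplexFunctions.
Variable R : realType.
Implicit Types (z w p : R[i]) (f : R -> R[i]).

Definition cmod z : R := complex.Re `|z|.

Definition cexp z : R[i] :=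
  (expR (complex.Re z))%:C * (cos (complex.Im z) +i* sin (complex.Im z)).

(* Principal argument, with values in ]-pi, pi] for z != 0. *)
Definition carg z : R :=
  if 0 <= complex.Im z then acos (complex.Re z / cmod z)
  else - acos (complex.Re z / cmod z).

Definition clog z : R[i] := ln (cmod z) +i* carg z.

(* Principal power z ^ w; meaningful for z != 0 only. *)
Definition cpow z w : R[i] := cexp (w * clog z).

(* Lebesgue integration of complex-valued functions over ]0, +oo[. *)
Definition cintegrable f : Prop :=
  lebesgue_measure.-integrable `]0%R, +oo[
    (fun t => (complex.Re (f t))%:E) /\
  lebesgue_measure.-integrable `]0%R, +oo[
    (fun t => (complex.Im (f t))%:E).

Definition cintegral f : R[i] :=
  Rintegral lebesgue_measure `]0%R, +oo[ (fun t => complex.Re (f t)) +i*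
  Rintegral lebesgue_measure `]0%R, +oo[ (fun t => complex.Im (f t)).

Definition laplace_kernel f p (t : R) : R[i] := f t * cexp (- (p * t%:C)).

(* Absolute convergence of the Laplace integral of f at p. *)
Definition laplace_exists f p : Prop := cintegrable (laplace_kernel f p).

Definition laplace f p : R[i] := cintegral (laplace_kernel f p).

(* Euler's integral; this is Gamma on the half-plane Re z > 0. *)
Definition euler_gamma z : R[i] :=
  cintegral (fun t => cpow t%:C (z - 1) * cexp (- t%:C)).

(* The Gamma function on the whole plane, extended to Re z <= 0 by
   Gamma z = Gamma (z + n) / (z (z + 1) ... (z + n - 1)), where n is the least
   natural number such that Re (z + n) > 0. At a pole the product vanishes, so
   that cgamma takes the value 0 there; hence (cgamma z)^-1 is the entire
   function 1 / Gamma everywhere, poles of Gamma included. *)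
Definition cgamma z : R[i] :=
  if 0 < complex.Re z then euler_gamma z
  else let n := (Num.truncn (- complex.Re z)).+1 in
       euler_gamma (z + n%:R) / \prod_(k < n) (z + k%:R).

Definition gamma_pole z : Prop := exists k : nat, z = - k%:R.

(* (z)_l = Gamma (z + l) / Gamma z for real l >= 0. When z and z + l are both
   poles, l is a natural number and the quotient is read as its limit
   z (z + 1) ... (z + l - 1); when only z is a pole, the quotient is 0, again
   its limit. When only z + l is a pole the quotient is infinite and the
   symbol has no value; the definition then returns 0. *)
Definition poch z (l : R) : R[i] :=
  if `[< gamma_pole z /\ gamma_pole (z + l%:C) >]
  then \prod_(k < Num.truncn l) (z + k%:R)
  else cgamma (z + l%:C) / cgamma z.

(* Double series over nat * nat. The sum is the limit of the square partial
   sums, which is the sum in any order for absolutely convergent series. *)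
Definition abs_convergent (a : nat -> nat -> R[i]) : Prop :=
  summable [set: nat * nat] (fun k => (cmod (a k.1 k.2))%:E).

Definition double_series (a : nat -> nat -> R[i]) : R[i] :=
  limn (fun N : nat => \sum_(m < N) \sum_(n < N) complex.Re (a m n)) +i*
  limn (fun N : nat => \sum_(m < N) \sum_(n < N) complex.Im (a m n)).

Definition D1_term
    (g1 : R[i]) (a1 b1 : R) (g2 : R[i]) (a2 : R) (g3 : R[i]) (b2 : R)
    (d1 : R[i]) (a3 b3 : R) (d2 : R[i]) (a4 : R) (d3 : R[i]) (b4 : R)
    (x y : R[i]) (m n : nat) : R[i] :=
  poch g1 (a1 * m%:R + b1 * n%:R) * poch g2 (a2 * m%:R) * poch g3 (b2 * n%:R)
    / cgamma (d1 + (a3 * m%:R + b3 * n%:R)%:C)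
  * (x ^+ m / cgamma (d2 + (a4 * m%:R)%:C))
  * (y ^+ n / cgamma (d3 + (b4 * n%:R)%:C)).

Definition D1 g1 a1 b1 g2 a2 g3 b2 d1 a3 b3 d2 a4 d3 b4 x y : R[i] :=
  double_series (D1_term g1 a1 b1 g2 a2 g3 b2 d1 a3 b3 d2 a4 d3 b4 x y).

Definition D1_region g1 a1 b1 g2 a2 g3 b2 d1 a3 b3 d2 a4 d3 b4 x y : Prop :=
  abs_convergent (D1_term g1 a1 b1 g2 a2 g3 b2 d1 a3 b3 d2 a4 d3 b4 x y).

Definition E11_term
    (g1 : R[i]) (a1 b1 : R) (g2 : R[i]) (a2 : R) (g3 : R[i]) (b2 : R)
    (d1 : R[i]) (a3 : R) (d2 : R[i]) (b3 : R)
    (x y : R[i]) (m n : nat) : R[i] :=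
  poch g1 (a1 * m%:R + b1 * n%:R) * poch g2 (a2 * m%:R) * poch g3 (b2 * n%:R)
  * (x ^+ m / cgamma (d1 + (a3 * m%:R)%:C))
  * (y ^+ n / cgamma (d2 + (b3 * n%:R)%:C)).

Definition E11 g1 a1 b1 g2 a2 g3 b2 d1 a3 d2 b3 x y : R[i] :=
  double_series (E11_term g1 a1 b1 g2 a2 g3 b2 d1 a3 d2 b3 x y).

Definition E11_region g1 a1 b1 g2 a2 g3 b2 d1 a3 d2 b3 x y : Prop :=
  abs_convergent (E11_term g1 a1 b1 g2 a2 g3 b2 d1 a3 d2 b3 x y).

End ComplexFunctions.

(* Main.v *)
Require Import Defs.
From mathcomp Require Import ring lra measurable_realfun.
Import Order.TTheory GRing.Theory Num.Theory.
Import numFieldNormedType.Exports.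
Local Open Scope classical_set_scope.
Local Open Scope ring_scope.
Local Open Scope complex_scope.
Set Implicit Arguments.
Unset Strict Implicit.
Unset Printing Implicit Defensive.

(** With w = d1 + a3 m + b3 n and A_mn the term of E11 at (x, y), the function
    f is the sum of A_mn t^(w-1) / Gamma w.  Integrating term by term against
    e^(-q t) and using

      int_0^oo t^(w-1) e^(-q t) dt = Gamma w / q^w     (Re w > 0, Re q > 0)

    ([euler_integral_cexp]) cancels Gamma w and leaves the sum of A_mn q^(-w),
    which is q^(-d1) times the E11 series.  Fubini's theorem asks for the
    summability of |A_mn| Gamma(Re w) / |Gamma w| (Re q)^(-Re w).  Since Im w
    is the same for all terms, Gamma(Re w) / |Gamma w| is bounded
    ([rgamma_le_cgamma]), so it is enough that the E11 series converges
    absolutely at Re q ([laplace_termwise]).  For q = p this is the existence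
    claim.

    The formula at p is harder, because only absolute convergence of E11 at p,
    that is at |p|, is known there, and Re p may be smaller than |p|: the
    integral of f(t) e^(-p t) may exist without being absolutely integrable
    term by term.  Both sides are therefore continued analytically along the
    ray p + s, s >= 0.  For s > |p| the termwise argument applies at p + s.
    On the other side, rotating the line of integration by th, the argument of
    p, turns the sum of A_mn (p + s)^(-w) into the Laplace integral, at
    e^(-i th) (p + s) = |p| + s e^(-i th), of the function h' with the
    coefficients A_mn e^(-i th w).  The real part of that point is at least
    |p|, so the termwise argument applies to h' for every s >= 0.  Thus the two
    sides are functions of s of the shape

      s |-> int_0^oo v(t) e^(- c t s) dt,  v integrable, Re c > 0, |c| <= 1,

    whose j-th derivatives are at most K j! / (Re c * s)^j.  Taylor's formula
    then carries the vanishing of their difference from large s down to every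
    s > 0 ([vanishing_continuation]) and continuity reaches s = 0
    ([laplace_continuation]). *)

(** * Complex modulus, exponential and logarithm *)

Section ComplexElementary.
Variable R : realType.
Implicit Types (z w q : R[i]) (x y t : R).

Lemma cmodE z : `|z| = (cmod z)%:C.
Proof. by rewrite /cmod normc_def. Qed.

Lemma cmod_sqrt z :
  cmod z = Num.sqrt (complex.Re z ^+ 2 + complex.Im z ^+ 2).
Proof. by rewrite /cmod normc_def. Qed.

Lemma cmod_ge0 z : 0 <= cmod z.
Proof. by rewrite cmod_sqrt sqrtr_ge0. Qed.

Lemma cmodM z w : cmod (z * w) = cmod z * cmod w.
Proof.
apply: complexI; rewrite -cmodE normrM !cmodE.
by rewrite rmorphM.
Qed.

Lemma cmodX z n : cmod (z ^+ n) = cmod z ^+ n.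
Proof.
apply: complexI; rewrite -cmodE normrX !cmodE.
by rewrite rmorphXn.
Qed.

Lemma cmodV z : cmod z^-1 = (cmod z)^-1.
Proof.
apply: complexI; rewrite -cmodE normfV !cmodE.
by rewrite fmorphV.
Qed.

Lemma cmodN z : cmod (- z) = cmod z.
Proof. by apply: complexI; rewrite -cmodE normrN cmodE. Qed.

Lemma cmodD z w : cmod (z + w) <= cmod z + cmod w.
Proof. by rewrite -lecR rmorphD -!cmodE ler_normD. Qed.

Lemma cmod_real x : cmod x%:C = `|x|.
Proof. by rewrite cmod_sqrt /= expr0n addr0 sqrtr_sqr. Qed.

Lemma cmod_gt0 z : (0 < cmod z) = (z != 0).
Proof. by rewrite -ltcR -cmodE normr_gt0. Qed.

Lemma ler_Re_cmod z : `|complex.Re z| <= cmod z.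
Proof.
by rewrite cmod_sqrt -sqrtr_sqr ler_wsqrtr// lerDl sqr_ge0.
Qed.

Lemma ler_Im_cmod z : `|complex.Im z| <= cmod z.
Proof.
by rewrite cmod_sqrt -sqrtr_sqr ler_wsqrtr// lerDr sqr_ge0.
Qed.

Lemma cexp_def x y :
  cexp (x +i* y) = (expR x * cos y) +i* (expR x * sin y).
Proof.
apply/eqP; rewrite eq_complex /=.
by apply/andP; split; apply/eqP; ring.
Qed.

Lemma cexpD z w : cexp (z + w) = cexp z * cexp w.
Proof.
case: z w => [a b] [c d]; rewrite [_ + _]/= !cexp_def.
rewrite expRD cosD sinD; apply/eqP; rewrite eq_complex /=.
by apply/andP; split; apply/eqP; ring.
Qed.

Lemma cexp0 : cexp (0 : R[i]) = 1.
Proof. by rewrite (_ : 0 = 0 +i* 0)// cexp_def expR0 cos0 sin0 mulr0 mulr1. Qed.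

Lemma cmod_cexp z : cmod (cexp z) = expR (complex.Re z).
Proof.
case: z => a b; rewrite cexp_def cmod_sqrt /= !exprMn -mulrDr cos2Dsin2 mulr1.
by rewrite sqrtr_sqr ger0_norm ?expR_ge0.
Qed.

Lemma cexp_neq0 z : cexp z != 0.
Proof. by rewrite -cmod_gt0 cmod_cexp expR_gt0. Qed.

Lemma cexpN z : cexp (- z) = (cexp z)^-1.
Proof.
apply: (mulfI (cexp_neq0 z)).
by rewrite -cexpD subrr cexp0 mulfV ?cexp_neq0.
Qed.

Lemma cexpMn z n : cexp z ^+ n = cexp (n%:R * z).
Proof.
elim: n => [|n IH]; first by rewrite expr0 mul0r cexp0.
by rewrite exprS IH -cexpD; congr cexp; rewrite -natr1 mulrDl mul1r addrC.
Qed.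

Lemma cexp_real x : cexp x%:C = (expR x)%:C.
Proof. by rewrite cexp_def cos0 sin0 mulr0 mulr1. Qed.

Lemma Re_mulc z w : complex.Re (z * w) =
  complex.Re z * complex.Re w - complex.Im z * complex.Im w.
Proof. by case: z w => [a b] [c d]. Qed.

Lemma Im_mulc z w : complex.Im (z * w) =
  complex.Re z * complex.Im w + complex.Im z * complex.Re w.
Proof. by case: z w => [a b] [c d]. Qed.

Lemma Re_addc z w : complex.Re (z + w) = complex.Re z + complex.Re w.
Proof. by case: z w => [a b] [c d]. Qed.

Lemma Im_addc z w : complex.Im (z + w) = complex.Im z + complex.Im w.
Proof. by case: z w => [a b] [c d]. Qed.

Lemma Re_oppc z : complex.Re (- z) = - complex.Re z.
Proof. by case: z. Qed.

Lemma Im_oppc z : complex.Im (- z) = - complex.Im z.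
Proof. by case: z. Qed.

(** The principal argument inverts z |-> exp z on the open strip of
    half-width pi. *)
Lemma clog_cexp z : `|complex.Im z| < pi -> clog (cexp z) = z.
Proof.
case: z => a b /=; rewrite ltr_norml => /andP[bl bu].
rewrite /clog cmod_cexp /= expRK; congr (_ +i* _).
rewrite /carg cmod_cexp cexp_def /=.
rewrite pmulr_rge0 ?expR_gt0// mulrAC divff ?gt_eqF ?expR_gt0// mul1r.
case: (lerP 0 b) => b0.
  by rewrite sin_ge0_pi ?b0 ?(ltW bu)// cosK// in_itv/= b0 ltW.
rewrite leNgt -oppr_gt0 -sinN sin_gt0_pi ?oppr_gt0 ?b0 ?(ltrNl _ pi)//=.
by rewrite cosKN ?opprK// (ltW b0) ltW.
Qed.

(** For Re q > 0 the argument of q is the arcsine of Im q / |q|. *)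
Lemma clog_right q : 0 < complex.Re q ->
  cexp (clog q) = q /\ `|complex.Im (clog q)| < pi / 2.
Proof.
move=> q0.
have m0 : 0 < cmod q by rewrite (lt_le_trans q0)// (le_trans (ler_norm _))// ler_Re_cmod.
pose s := complex.Im q / cmod q.
have s2 : 1 - s ^+ 2 = (complex.Re q / cmod q) ^+ 2.
  rewrite /s !exprMn -[1](@divff _ (cmod q ^+ 2)) ?lt0r_neq0 ?exprn_gt0//.
  rewrite exprVn -mulrBl; congr (_ * _).
  by rewrite cmod_sqrt sqr_sqrtr ?addrK// addr_ge0 ?sqr_ge0.
have s2lt : s ^+ 2 < 1 by rewrite -subr_gt0 s2 exprn_gt0// divr_gt0.
have /andP[sl su] : -1 < s < 1 by nra.
pose z := (ln (cmod q)) +i* asin s.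
have ez : cexp z = q.
  rewrite cexp_def lnK ?posrE// cos_asin ?(ltW sl) ?(ltW su)// s2 sqrtr_sqr.
  rewrite asinK ?in_itv/= ?(ltW sl) ?(ltW su)// ger0_norm ?divr_ge0 ?ltW//.
  by rewrite /s !mulrA ![cmod q * _]mulrC !mulfK ?lt0r_neq0//; case: (q).
have zI : `|complex.Im z| < pi / 2.
  by rewrite ltr_norml asin_gtNpi2 ?sl ?ltW// asin_ltpi2 ?su ?ltW.
have zpi : `|complex.Im z| < pi by apply: lt_trans zI _; have := @pi_gt0 R; lra.
by rewrite -{1 3}ez clog_cexp.
Qed.

Lemma clog_real x : 0 < x -> clog x%:C = (ln x)%:C.
Proof.
move=> x0; rewrite -{1}(@lnK _ x) ?posrE// -cexp_real clog_cexp//=.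
by rewrite normr0 pi_gt0.
Qed.

Lemma cpow_real x w : 0 < x -> cpow x%:C w = cexp (w * (ln x)%:C).
Proof. by move=> x0; rewrite /cpow clog_real. Qed.

End ComplexElementary.

(** * Derivatives of complex-valued functions of a real variable *)

Section ComplexDerivative.
Variable R : realType.
Implicit Types (f g : R -> R[i]) (z w : R[i]) (x : R).

(** Componentwise, as the integrals of complex-valued functions are. *)
Definition cderiv f x z : Prop :=
  is_derive x 1 (fun t => complex.Re (f t)) (complex.Re z) /\
  is_derive x 1 (fun t => complex.Im (f t)) (complex.Im z).

Lemma cderiv_real (r : R -> R) x (dr : R) :
  is_derive x 1 r dr -> cderiv (fun t => (r t)%:C) x dr%:C.
Proof. by move=> dr1; split=> //=; exact: is_derive_cst. Qed.

Lemma cderiv_cst w x : cderiv (fun=> w) x 0.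
Proof. by split=> /=; exact: is_derive_cst. Qed.

Lemma cderivD f g x z w : cderiv f x z -> cderiv g x w ->
  cderiv (fun t => f t + g t) x (z + w).
Proof.
move=> [f1 f2] [g1 g2]; split.
  by under eq_fun do rewrite Re_addc; rewrite Re_addc; exact: is_deriveD.
by under eq_fun do rewrite Im_addc; rewrite Im_addc; exact: is_deriveD.
Qed.

Lemma cderivN f x z : cderiv f x z -> cderiv (fun t => - f t) x (- z).
Proof.
move=> [f1 f2]; split.
  by under eq_fun do rewrite Re_oppc; rewrite Re_oppc; exact: is_deriveN.
by under eq_fun do rewrite Im_oppc; rewrite Im_oppc; exact: is_deriveN.
Qed.

Lemma cderivM f g x z w : cderiv f x z -> cderiv g x w ->
  cderiv (fun t => f t * g t) x (z * g x + f x * w).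
Proof.
move=> [f1 f2] [g1 g2]; split.
  under eq_fun do rewrite Re_mulc.
  apply: is_derive_eq; rewrite Re_addc !Re_mulc /GRing.scale/=; ring.
under eq_fun do rewrite Im_mulc.
apply: is_derive_eq; rewrite Im_addc !Im_mulc /GRing.scale/=; ring.
Qed.

Lemma cderivZ w f x z : cderiv f x z -> cderiv (fun t => w * f t) x (w * z).
Proof.
move=> fz; have := cderivM (cderiv_cst w x) fz.
by rewrite mul0r add0r.
Qed.

Lemma cderiv_cexp f x z : cderiv f x z ->
  cderiv (fun t => cexp (f t)) x (z * cexp (f x)).
Proof.
move=> [f1 f2].
have dexp := is_derive1_comp (is_derive_expR (complex.Re (f x))) f1.
have dcos := is_derive1_comp (is_derive_cos (complex.Im (f x))) f2.
have dsin := is_derive1_comp (is_derive_sin (complex.Im (f x))) f2.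
have E t : cexp (f t) =
    (expR (complex.Re (f t)) * cos (complex.Im (f t))) +i*
    (expR (complex.Re (f t)) * sin (complex.Im (f t))).
  by rewrite -cexp_def; case: (f t).
split.
  under eq_fun do rewrite E /=.
  apply: (is_derive_eq (is_deriveM dexp dcos)).
  rewrite E Re_mulc /GRing.scale/=; ring.
under eq_fun do rewrite E /=.
apply: (is_derive_eq (is_deriveM dexp dsin)).
rewrite E Im_mulc /GRing.scale/=; ring.
Qed.

End ComplexDerivative.

(** * Integration over the positive half-line *)

Section HalfLine.
Variable R : realType.
Implicit Types (f g F : R -> R) (t x : R).
Local Notation mu := (@lebesgue_measure R).
Local Notation Rpos := (`]0%R, +oo[%classic : set R).

Lemma in_Rpos t : Rpos t = (0 < t).
Proof. by rewrite /= in_itv/= andbT. Qed.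

Lemma measurable_Rpos : measurable (Rpos : set (measurableTypeR R)).
Proof. exact: measurable_itv. Qed.

Lemma is_derive_continuous f x (df : R) :
  is_derive x 1 f df -> {for x, continuous f}.
Proof.
by move=> fx; apply/differentiable_continuous/derivable1_diffP; case: fx.
Qed.

Lemma Rpos_continuous_measurable f :
  (forall t, 0 < t -> {for t, continuous f}) -> measurable_fun Rpos f.
Proof.
move=> cf; apply: open_continuous_measurable_fun; first exact: interval_open.
by move=> t; rewrite inE in_Rpos; exact: cf.
Qed.

Lemma Rpos_le_integrable f g : measurable_fun Rpos f ->
  (forall t, 0 < t -> `|f t| <= g t) ->
  mu.-integrable Rpos (EFin \o g) -> mu.-integrable Rpos (EFin \o f).
Proof.
move=> mf fg; apply: le_integrable; first exact: measurable_Rpos.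
  exact/measurable_EFinP.
move=> t; rewrite in_Rpos => t0 /=.
by rewrite lee_fin (le_trans (fg _ t0))// ler_norm.
Qed.

Lemma Rpos_integrable_fin g : measurable_fun Rpos g ->
  (forall t, 0 < t -> 0 <= g t) ->
  (\int[mu]_(t in Rpos) (g t)%:E < +oo)%E ->
  mu.-integrable Rpos (EFin \o g).
Proof.
move=> mg g0 gy; apply/integrableP; split; first exact/measurable_EFinP.
rewrite (le_lt_trans _ gy)// le_eqVlt; apply/orP; left; apply/eqP.
apply: eq_integral => t; rewrite inE in_Rpos => t0.
by rewrite /= ger0_norm ?g0.
Qed.

Lemma Rpos_integrableZl (k : R) f :
  mu.-integrable Rpos (EFin \o f) ->
  mu.-integrable Rpos (EFin \o (fun t => k * f t)).
Proof.
move=> fi; have := integrableZl (@measurable_Rpos) k fi.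
by apply: eq_integrable => // t _; rewrite /= EFinM.
Qed.

Lemma Rpos_integrableD f g :
  mu.-integrable Rpos (EFin \o f) -> mu.-integrable Rpos (EFin \o g) ->
  mu.-integrable Rpos (EFin \o (fun t => f t + g t)).
Proof.
move=> fi gi; have := integrableD (@measurable_Rpos) fi gi.
by apply: eq_integrable => // t _; rewrite /= EFinD.
Qed.

Lemma Rpos_integrableB f g :
  mu.-integrable Rpos (EFin \o f) -> mu.-integrable Rpos (EFin \o g) ->
  mu.-integrable Rpos (EFin \o (fun t => f t - g t)).
Proof.
move=> fi gi; have := integrableB (@measurable_Rpos) fi gi.
by apply: eq_integrable => // t _; rewrite /= EFinB.
Qed.

(** The endpoints are exponentials, so that the logarithm of an endpoint is
    an integer and the decay of t^s e^(-d t) there can be read off directly. *)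
Definition window (n : nat) : set R := `[expR (- n.+1%:R), expR n.+1%:R]%classic.

Lemma window_pos n t : window n t -> 0 < t.
Proof. by rewrite /window /= in_itv/= => /andP[+ _]; apply: lt_le_trans; exact: expR_gt0. Qed.

Lemma window_sub m n : (m <= n)%N -> window m `<=` window n.
Proof.
move=> mn t; rewrite /window /= !in_itv/= => /andP[a b]; apply/andP; split.
  by rewrite (le_trans _ a)// ler_expR lerN2 ler_nat ltnS.
by rewrite (le_trans b)// ler_expR ler_nat ltnS.
Qed.

Lemma window_near t : 0 < t -> \forall n \near \oo, window n t.
Proof.
move=> t0; near=> n; rewrite /window /= in_itv/=.
rewrite -[t]lnK ?posrE// !ler_expR.
rewrite -ler_norml.
have h : `|ln t| <= n%:R by near: n; exact: nbhs_infty_ger.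
by rewrite (le_trans h)// ler_nat.
Unshelve. all: by end_near. Qed.

Lemma bigcup_window : \bigcup_n window n = Rpos.
Proof.
apply/seteqP; split => [t [n _] /window_pos|t].
  by rewrite in_Rpos.
rewrite in_Rpos => /window_near[n _ h]; exists n => //.
by apply: h => /=.
Qed.

Lemma measurable_window n : measurable (window n : set (measurableTypeR R)).
Proof. exact: measurable_itv. Qed.

Lemma integral_window F g n :
  (forall t, 0 < t -> is_derive t 1 F (g t)) ->
  (forall t, 0 < t -> {for t, continuous g}) ->
  (\int[mu]_(t in window n) (g t)%:E =
    (F (expR n.+1%:R))%:E - (F (expR (- n.+1%:R)))%:E)%E.
Proof.
move=> dF cg; apply: continuous_FTC2.
- by rewrite ltr_expR (@lt_trans _ _ 0)// ?oppr_lt0 ltr0n.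
- apply/continuous_in_subspaceT => t; rewrite inE => /window_pos; exact: cg.
- split.
  + move=> t; rewrite in_itv/= => /andP[+ _] => ht.
    by have [] := dF _ (lt_trans (expR_gt0 _) ht).
  + apply: cvg_at_right_filter; apply: is_derive_continuous.
    by apply: dF; exact: expR_gt0.
  + apply: cvg_at_left_filter; apply: is_derive_continuous.
    by apply: dF; exact: expR_gt0.
- move=> t; rewrite in_itv/= => /andP[+ _] => ht.
  by rewrite derive1E; apply: derive_val; apply: dF; exact: (lt_trans (expR_gt0 _) ht).
Qed.

(** The integral of g over each window is a difference of values of F, hence
    at most M; monotone convergence extends the bound to the half-line. *)
Lemma bounded_primitive_integrable F g (M : R) :
  (forall t, 0 < t -> is_derive t 1 F (g t)) ->
  (forall t, 0 < t -> {for t, continuous g}) ->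
  (forall t, 0 < t -> 0 <= g t) ->
  (forall t, 0 < t -> 0 <= F t <= M) ->
  mu.-integrable Rpos (EFin \o g).
Proof.
move=> dF cg g0 FM.
have mg := Rpos_continuous_measurable cg.
apply: Rpos_integrable_fin => //.
apply: (@le_lt_trans _ _ M%:E); last exact: ltry.
rewrite -bigcup_window.
have cv : (\int[mu]_(x in window i) (g x)%:E @[i --> \oo] -->
    \int[mu]_(x in \bigcup_i window i) (g x)%:E)%E.
  apply: ge0_nondecreasing_set_cvg_integral.
  - by apply/nondecreasing_seqP => n; rewrite subsetEset; exact: window_sub.
  - exact: measurable_window.
  - move=> n; apply/measurable_EFinP; apply: measurable_funS mg.
      exact: measurable_Rpos.
    by move=> t /window_pos; rewrite in_Rpos.
  - by move=> n t /window_pos t0; rewrite lee_fin g0.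
rewrite -(cvg_lim _ cv)//.
apply: lime_le; first exact: (cvgP _ cv).
apply: nearW => n; rewrite (integral_window _ dF cg) -EFinB lee_fin.
have /andP[_ a] := FM _ (expR_gt0 n.+1%:R).
have /andP[b _] := FM _ (expR_gt0 (- n.+1%:R)).
by rewrite lerBlDr (le_trans a)// lerDl.
Qed.

(** Dominated convergence, from the windows to the half-line. *)
Lemma improper_FTC0 F g :
  (forall t, 0 < t -> is_derive t 1 F (g t)) ->
  (forall t, 0 < t -> {for t, continuous g}) ->
  mu.-integrable Rpos (EFin \o g) ->
  F (expR n.+1%:R) @[n --> \oo] --> 0 ->
  F (expR (- n.+1%:R)) @[n --> \oo] --> 0 ->
  \int[mu]_(t in Rpos) g t = 0.
Proof.
move=> dF cg ig Fy F0.
have mg := Rpos_continuous_measurable cg.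
pose gn n := (EFin \o g) \_ (window n).
have [] := @dominated_convergence _ _ R mu Rpos measurable_Rpos
  gn (EFin \o g) (fun t => `|(g t)%:E|)%E.
- move=> n.
  have mR : measurable_fun (Rpos `&` window n) (EFin \o g : measurableTypeR R -> \bar R).
    apply/measurable_EFinP; apply: measurable_funS mg.
      exact: measurable_Rpos.
    by move=> t [].
  exact: (measurable_restrict _ (measurable_window n) measurable_Rpos).1 mR.
- exact/measurable_EFinP.
- apply: aeW => t; rewrite in_Rpos => t0.
  apply: cvg_near_cst; have := window_near t0; apply: filterS => n nt.
  by rewrite /gn patchE mem_set.
- exact: integrable_abse.
- apply: aeW => t n _; rewrite /gn patchE.
  by case: ifP => //= _; rewrite normr0 lee_fin.
move=> _ _ cv.
have Ein n : (\int[mu]_(x in Rpos) gn n x =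
    (F (expR n.+1%:R) - F (expR (- n.+1%:R)))%:E)%E.
  rewrite -integral_mkcondr setIC setIidl; last first.
    by move=> t /window_pos; rewrite in_Rpos.
  by rewrite EFinB; exact: integral_window.
have cv2 : (fun n => \int[mu]_(x in Rpos) gn n x)%E @ \oo --> 0%:E.
  under eq_fun do rewrite Ein.
  apply: cvg_EFin; first exact: nearW.
  by rewrite /comp/= -[X in _ --> X]subr0; exact: cvgB.
rewrite /Rintegral.
by rewrite (_ : (\int[mu]_(x in Rpos) (g x)%:E)%E = 0%:E)//; exact: (cvg_unique _ cv cv2).
Qed.

End HalfLine.

(** * The kernel t^w e^(-q t) *)

Section EulerKernel.
Variable R : realType.
Implicit Types (s d t x a c : R) (v w q : R[i]).
Local Notation mu := (@lebesgue_measure R).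
Local Notation Rpos := (`]0%R, +oo[%classic : set R).

(** t^s e^(-d t) as a single exponential: products, moduli and derivatives of
    such kernels are computed in the exponent. *)
Definition rkernel s d t : R := expR (s * ln t - d * t).

Definition ekernel w q t : R[i] := cexp (w * (ln t)%:C - q * t%:C).

Lemma cmod_ekernel w q t :
  cmod (ekernel w q t) = rkernel (complex.Re w) (complex.Re q) t.
Proof.
rewrite cmod_cexp /rkernel Re_addc Re_oppc !Re_mulc /=.
by rewrite !mulr0 !subr0.
Qed.

(** This is ln x < x at x = t c / a. *)
Lemma ln_le_linear a c t : 0 < a -> 0 < c -> 0 < t ->
  a * ln t <= c * t + a * ln (a / c).
Proof.
move=> a0 c0 t0.
have := @ln_sublinear _ (t / (a / c)) ltac:(by rewrite !divr_gt0).
rewrite ln_div ?posrE ?divr_gt0// => /ltW; rewrite lerBlDr.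
rewrite -(ler_pM2l a0) mulrDr => /le_trans; apply.
rewrite lerD2r. have -> : a * (t / (a / c)) = c * t by field; rewrite !gt_eqF.
by [].
Qed.

Lemma rkernel_bounded s d : 0 < s -> 0 < d ->
  exists K, forall t, 0 < t -> rkernel s d t <= K.
Proof.
move=> s0 d0; exists (expR (s * ln (s / d))) => t t0.
by rewrite ler_expR lerBlDr addrC ln_le_linear.
Qed.

Lemma is_derive_ekernel w q t : 0 < t ->
  cderiv (ekernel w q) t (w * ekernel (w - 1) q t - q * ekernel w q t).
Proof.
move=> t0.
have dl : cderiv (fun t => (ln t)%:C) t t^-1%:C.
  exact: cderiv_real (is_derive1_ln t0).
have di : cderiv (fun t : R => t%:C) t 1%:C.
  exact: (cderiv_real (is_derive_id _ _)).
have := cderiv_cexp (cderivD (cderivZ w dl) (cderivN (cderivZ q di))).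
congr (cderiv _ _ _).
rewrite -/(ekernel w q t) mulrDl mulr1 mulNr; congr (_ - _).
rewrite -mulrA; congr (_ * _).
have -> : t^-1%:C = cexp (- (ln t)%:C).
  by rewrite cexpN cexp_real lnK ?posrE// fmorphV.
by rewrite /ekernel -cexpD mulrBl mul1r; congr cexp; ring.
Qed.

Lemma continuous_ekernel v w q t : 0 < t ->
  {for t, continuous (fun t => complex.Re (v * ekernel w q t))}.
Proof.
move=> t0; have [h _] := cderivZ v (is_derive_ekernel w q t0).
exact: is_derive_continuous h.
Qed.

Lemma rkernelE s d t : rkernel s d t = complex.Re (1 * ekernel s%:C d%:C t).
Proof.
by rewrite mul1r /ekernel -!rmorphM -rmorphB cexp_real.
Qed.

Lemma continuous_rkernel s d t : 0 < t -> {for t, continuous (rkernel s d)}.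
Proof.
move=> t0; rewrite (_ : rkernel s d = (fun t => complex.Re (1 * ekernel s%:C d%:C t))).
  exact: continuous_ekernel.
by apply/funext => u; exact: rkernelE.
Qed.

(** Comparison with the derivative of the bounded function
    t^s / (1 + t^s): the quotient is (1 + t^s)^2 e^(-d t) / s, which is
    bounded. *)
Lemma rkernel_integrable s d : 0 < s -> 0 < d ->
  mu.-integrable Rpos (EFin \o rkernel (s - 1) d).
Proof.
move=> s0 d0.
pose E t := expR (s * ln t).
pose F t := 1 - (1 + E t)^-1.
pose g t := s * t^-1 * E t * ((1 + E t) * (1 + E t))^-1.
have dE t : 0 < t -> is_derive t 1 E (s * t^-1 * E t).
  move=> t0; have dl := is_derive1_ln t0.
  have H := @is_derive1_comp _ expR (fun t => s * ln t) t _ _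
    (is_derive_expR _) (is_deriveZ s dl).
  by apply: (is_derive_eq H); rewrite /GRing.scale/= mulrC.
have E1 t : 0 < 1 + E t by rewrite addr_gt0 ?expR_gt0.
have dF t : 0 < t -> is_derive t 1 F (g t).
  move=> t0; have := dE _ t0 => dEt.
  have n0 : 1 + E t != 0 by rewrite gt_eqF.
  have d1 : is_derive t 1 (fun t => 1 + E t) (s * t^-1 * E t).
    have H : is_derive t 1 (cst (1 : R) + E) (0 + s * t^-1 * E t).
      by apply: is_deriveD.
    by rewrite add0r in H.
  have H : is_derive t 1 (fun t => (1 + E t)^-1) (- (1 + E t) ^- 2 *: (s * t^-1 * E t)).
    have [d1a d1b] := d1.
    by apply: DeriveDef; [exact: derivableV|rewrite deriveV// d1b].
  have H2 : is_derive t 1 (cst (1 : R) - (fun t => (1 + E t)^-1))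
      (0 - - (1 + E t) ^- 2 *: (s * t^-1 * E t)) by apply: is_deriveB.
  apply: (is_derive_eq H2).
  by rewrite /GRing.scale/= sub0r mulNr opprK /g mulrC expr2.
have cg t : 0 < t -> {for t, continuous g}.
  move=> t0; apply: cvgM.
    apply: cvgM; last exact: is_derive_continuous (dE _ t0).
    apply: cvgM; first exact: cvg_cst.
    by apply: cvgV; [rewrite gt_eqF|exact: cvg_id].
  have c1 : (1 + E u) @[u --> t] --> 1 + E t.
    by apply: cvgD; [exact: cvg_cst|exact: is_derive_continuous (dE _ t0)].
  by apply: cvgV; [rewrite gt_eqF// mulr_gt0|exact: cvgM].
have g0 t : 0 < t -> 0 <= g t.
  move=> t0; by rewrite /g !mulr_ge0 ?invr_ge0 ?mulr_ge0 ?(ltW t0) ?(ltW s0) ?expR_ge0 ?(ltW (E1 t)).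
have Fb t : 0 < t -> 0 <= F t <= 1.
  move=> t0; rewrite /F subr_ge0 invf_le1// lerDl expR_ge0/=.
  by rewrite lerBlDr lerDl invr_ge0 ltW.
have ig := bounded_primitive_integrable dF cg g0 Fb.
have [K HK] := @rkernel_bounded (2 * s) d ltac:(by rewrite mulr_gt0) d0.
have iC := Rpos_integrableZl ((2 + 2 * K) / s) ig.
apply: (Rpos_le_integrable _ _ iC).
  by apply: Rpos_continuous_measurable; exact: continuous_rkernel.
move=> t t0; rewrite ger0_norm ?expR_ge0//.
have -> : rkernel (s - 1) d t = t^-1 * E t * expR (- (d * t)).
  rewrite -[t in t^-1]lnK ?posrE// -expRN -!expRD; congr expR; ring.
have -> : (2 + 2 * K) / s * g t =
    t^-1 * E t * ((2 + 2 * K) * (1 + E t) ^- 2).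
  rewrite /g; field; rewrite !gt_eqF//.
rewrite ler_pM2l ?mulr_gt0 ?invr_gt0 ?expR_gt0// ler_pdivlMr ?exprn_gt0//.
have hE : E t ^+ 2 * expR (- (d * t)) <= K.
  apply: le_trans (HK _ t0); rewrite /E /rkernel -expRM_natl -expRD.
  by rewrite ler_expR mulrA.
have e1 : expR (- (d * t)) <= 1 by rewrite expR_le1 oppr_le0 mulr_ge0 ?ltW.
have e0 := expR_ge0 (- (d * t)).
have := mulr_ge0 e0 (sqr_ge0 (1 - E t)).
nra.
Qed.

End EulerKernel.

(** * Integrals of complex-valued functions *)

Section ComplexIntegral.
Variable R : realType.
Implicit Types (f g : R -> R[i]) (c z w q : R[i]) (b : R -> R).
Local Notation mu := (@lebesgue_measure R).
Local Notation Rpos := (`]0%R, +oo[%classic : set R).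

Definition cmeasurable f : Prop :=
  measurable_fun Rpos (fun t => complex.Re (f t)) /\
  measurable_fun Rpos (fun t => complex.Im (f t)).

Lemma cintegrable_measurable f : cintegrable f -> cmeasurable f.
Proof.
by move=> [/measurable_int/measurable_EFinP ? /measurable_int/measurable_EFinP ?].
Qed.

Lemma cmeasurableM f g : cmeasurable f -> cmeasurable g ->
  cmeasurable (fun t => f t * g t).
Proof.
move=> [f1 f2] [g1 g2]; split => /=.
  under [X in measurable_fun _ X]eq_fun do rewrite Re_mulc.
  by apply: measurable_funB; apply: measurable_funM.
under [X in measurable_fun _ X]eq_fun do rewrite Im_mulc.
by apply: measurable_funD; apply: measurable_funM.
Qed.

Lemma cmeasurable_cst c : cmeasurable (fun=> c).
Proof. by split; exact: measurable_cst. Qed.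

Lemma cderiv_measurable f (df : R -> R[i]) :
  (forall t, 0 < t -> cderiv f t (df t)) -> cmeasurable f.
Proof.
move=> dfE; split; apply: Rpos_continuous_measurable => t t0.
  exact: is_derive_continuous (dfE t t0).1.
exact: is_derive_continuous (dfE t t0).2.
Qed.

Lemma cintegrable_le f b : cmeasurable f ->
  (forall t, 0 < t -> cmod (f t) <= b t) ->
  mu.-integrable Rpos (EFin \o b) -> cintegrable f.
Proof.
move=> [f1 f2] fb ib; split.
  apply: (Rpos_le_integrable f1 _ ib) => t t0.
  by rewrite (le_trans (ler_Re_cmod _))// fb.
apply: (Rpos_le_integrable f2 _ ib) => t t0.
by rewrite (le_trans (ler_Im_cmod _))// fb.
Qed.

Lemma eq_cintegral f g : (forall t, 0 < t -> f t = g t) ->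
  cintegral f = cintegral g.
Proof.
move=> fg; rewrite /cintegral; congr (_ +i* _); apply: eq_Rintegral => t;
  by rewrite inE in_Rpos => t0; rewrite fg.
Qed.

Lemma eq_cintegrable f g : (forall t, 0 < t -> f t = g t) ->
  cintegrable f -> cintegrable g.
Proof.
by move=> fg [f1 f2]; split;
  [move: f1|move: f2]; apply: eq_integrable => // t;
  rewrite inE in_Rpos => t0; rewrite fg.
Qed.

(** The modulus is dominated by the sum of the absolute values of the two
    components. *)
Lemma cintegrable_cmod f : cintegrable f ->
  mu.-integrable Rpos (EFin \o (fun t => cmod (f t))).
Proof.
move=> fi; have [m1 m2] := cintegrable_measurable fi; case: fi => f1 f2.
have a1 := integrable_norm f1; have a2 := integrable_norm f2.
have a12 := Rpos_integrableD a1 a2.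
apply: (Rpos_le_integrable _ _ a12).
  under [X in measurable_fun _ X]eq_fun do rewrite cmod_sqrt.
  apply: measurableT_comp; first exact: continuous_measurable_fun (@sqrt_continuous R).
  by apply: measurable_funD; exact: measurable_funX.
move=> t t0; rewrite ger0_norm ?cmod_ge0//.
have := cmodD (complex.Re (f t))%:C ('i * (complex.Im (f t))%:C).
rewrite -complexE => /le_trans; apply.
by rewrite cmodM !cmod_real cmod_sqrt /= expr0n/= add0r expr1n sqrtr1 mul1r.
Qed.

Lemma cintegrableD f g : cintegrable f -> cintegrable g ->
  cintegrable (fun t => f t + g t).
Proof.
move=> [f1 f2] [g1 g2]; split => /=.
  apply: eq_integrable (Rpos_integrableD f1 g1) => // t _.
  by rewrite /= Re_addc.
apply: eq_integrable (Rpos_integrableD f2 g2) => // t _.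
by rewrite /= Im_addc.
Qed.

Lemma cintegralD f g : cintegrable f -> cintegrable g ->
  cintegral (fun t => f t + g t) = cintegral f + cintegral g.
Proof.
move=> [f1 f2] [g1 g2]; rewrite /cintegral.
rewrite (_ : _ +i* _ + _ = (Rintegral mu Rpos (fun t => complex.Re (f t)) +
   Rintegral mu Rpos (fun t => complex.Re (g t))) +i*
   (Rintegral mu Rpos (fun t => complex.Im (f t)) +
   Rintegral mu Rpos (fun t => complex.Im (g t))))//.
congr (_ +i* _).
  under eq_Rintegral do rewrite Re_addc.
  by rewrite RintegralD//; exact: measurable_Rpos.
under eq_Rintegral do rewrite Im_addc.
by rewrite RintegralD//; exact: measurable_Rpos.
Qed.

Lemma cintegrableZ c f : cintegrable f -> cintegrable (fun t => c * f t).
Proof.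
move=> [f1 f2]; split => /=.
  apply: eq_integrable (Rpos_integrableB (Rpos_integrableZl (complex.Re c) f1)
    (Rpos_integrableZl (complex.Im c) f2)) => // t _.
  by rewrite /= Re_mulc.
apply: eq_integrable (Rpos_integrableD (Rpos_integrableZl (complex.Re c) f2)
  (Rpos_integrableZl (complex.Im c) f1)) => // t _.
by rewrite /= Im_mulc.
Qed.

Lemma cintegralZ c f : cintegrable f ->
  cintegral (fun t => c * f t) = c * cintegral f.
Proof.
move=> [f1 f2]; rewrite /cintegral; apply/eqP; rewrite eq_complex.
rewrite Re_mulc Im_mulc /=; apply/andP; split; apply/eqP.
  under eq_Rintegral do rewrite Re_mulc.
  rewrite RintegralB ?RintegralZl//; try exact: measurable_Rpos.
    exact: Rpos_integrableZl.
  exact: Rpos_integrableZl.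
under eq_Rintegral do rewrite Im_mulc.
rewrite RintegralD ?RintegralZl//; try exact: measurable_Rpos.
  exact: Rpos_integrableZl.
exact: Rpos_integrableZl.
Qed.

Lemma cintegrableN f : cintegrable f -> cintegrable (fun t => - f t).
Proof.
move=> fi; apply: eq_cintegrable (cintegrableZ (-1) fi) => t _.
by rewrite mulN1r.
Qed.

Lemma cintegralB f g : cintegrable f -> cintegrable g ->
  cintegral (fun t => f t - g t) = cintegral f - cintegral g.
Proof.
move=> fi gi; rewrite cintegralD//; last exact: cintegrableN.
congr (_ + _); rewrite -mulN1r -cintegralZ//.
by apply: eq_cintegral => t _; rewrite mulN1r.
Qed.

Lemma derive_under_Rpos_integral (k k' : R -> R -> R) (G : R -> R) (a u v : R) :
  u < a < v ->
  (forall x, u < x < v -> mu.-integrable Rpos (EFin \o k x)) ->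
  (forall x t, u < x < v -> 0 < t -> is_derive x 1 (k ^~ t) (k' x t)) ->
  (forall x t, u < x < v -> 0 < t -> `|k' x t| <= G t) ->
  mu.-integrable Rpos (EFin \o G) ->
  is_derive a 1 (fun x => \int[mu]_(t in Rpos) k x t)
    (\int[mu]_(t in Rpos) k' a t).
Proof.
move=> auv ki dk kG iG.
have Ia : `]u, v[%classic a by rewrite /= in_itv/=.
have d1 x t : `]u, v[%classic x -> Rpos t -> derivable (k ^~ t) x 1.
  by rewrite in_Rpos /= in_itv/= => xuv t0; case: (dk x t xuv t0).
have e1 x t : u < x < v -> 0 < t -> partial1of2 k x t = k' x t.
  by move=> xuv t0; rewrite partial1of2E; apply: derive_val; exact: dk.
have iG' : mu.-integrable Rpos (EFin \o (fun t => `|G t|)).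
  exact: integrable_norm.
have b1 x t : `]u, v[%classic x -> Rpos t -> `|partial1of2 k x t| <= `|G t|.
  rewrite in_Rpos /= in_itv/= => xuv t0; rewrite e1//.
  by rewrite (le_trans (kG _ _ xuv t0))// ler_norm.
have i1 x : `]u, v[%classic x -> mu.-integrable Rpos (EFin \o k x).
  by rewrite /= in_itv/=; exact: ki.
have G0 t : 0 <= `|G t| by [].
apply: DeriveDef.
  exact: (derivable_under_integral (@measurable_Rpos R) Ia i1 d1 G0 iG' b1).
rewrite -derive1E.
rewrite (differentiation_under_integral (@measurable_Rpos R) Ia i1 d1 G0 iG' b1).
by apply: eq_Rintegral => t; rewrite inE in_Rpos => t0; rewrite e1.
Qed.

Lemma cderiv_under_integral (k k' : R -> R -> R[i]) (G : R -> R) (a u v : R) :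
  u < a < v ->
  (forall x, u < x < v -> cintegrable (k x)) ->
  (forall x t, u < x < v -> 0 < t -> cderiv (k ^~ t) x (k' x t)) ->
  (forall x t, u < x < v -> 0 < t -> cmod (k' x t) <= G t) ->
  mu.-integrable Rpos (EFin \o G) ->
  cderiv (fun x => cintegral (k x)) a (cintegral (k' a)).
Proof.
move=> auv ki dk kG iG; split => /=.
  apply: (@derive_under_Rpos_integral
    (fun x t => complex.Re (k x t)) (fun x t => complex.Re (k' x t)) G a u v) => //.
  - by move=> x xuv; exact: (ki x xuv).1.
  - by move=> x t xuv t0; exact: (dk x t xuv t0).1.
  - by move=> x t xuv t0; rewrite (le_trans (ler_Re_cmod _))// kG.
apply: (@derive_under_Rpos_integral
    (fun x t => complex.Im (k x t)) (fun x t => complex.Im (k' x t)) G a u v) => //.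
- by move=> x xuv; exact: (ki x xuv).2.
- by move=> x t xuv t0; exact: (dk x t xuv t0).2.
- by move=> x t xuv t0; rewrite (le_trans (ler_Im_cmod _))// kG.
Qed.

End ComplexIntegral.

(** * Euler's integral at a complex scale *)

Section EulerIntegral.
Variable R : realType.
Implicit Types (w q z : R[i]) (s d t u : R).
Local Notation mu := (@lebesgue_measure R).
Local Notation Rpos := (`]0%R, +oo[%classic : set R).

(* both unfold to expressions that rewriting with ring identities would match *)
Local Opaque cexp cmod.

Lemma cderiv0_constant (f : R -> R[i]) (a b : R) : a < b ->
  (forall x, a <= x <= b -> cderiv f x 0) -> f a = f b.
Proof.
move=> ab df.
suff H (g : R -> R) : (forall x, a <= x <= b -> is_derive x 1 g 0) -> g a = g b.
  have := H (fun t => complex.Re (f t)) (fun x xab => (df x xab).1).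
  have := H (fun t => complex.Im (f t)) (fun x xab => (df x xab).2).
  by case: (f a) (f b) => ? ? [? ?] /= -> ->.
move=> dg; have [] := @MVT _ g (fun=> 0) a b ab.
- by move=> x; rewrite in_itv/= => /andP[ax xb]; apply: dg; rewrite !ltW.
- apply/derivable_within_continuous => x; rewrite in_itv/= => xab.
  by case: (dg _ xab).
- by move=> c _; rewrite mul0r => /eqP; rewrite subr_eq0 => /eqP.
Qed.

Lemma ekernelS w q t : 0 < t -> t%:C * ekernel (w - 1) q t = ekernel w q t.
Proof.
move=> t0; rewrite -{1}[t]lnK ?posrE// -cexp_real -cexpD; congr cexp; ring.
Qed.

Lemma ekernel_measurable w q : cmeasurable (ekernel w q).
Proof. by apply: cderiv_measurable => t; exact: is_derive_ekernel. Qed.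

Lemma ekernel_integrable w q : 0 < complex.Re w -> 0 < complex.Re q ->
  cintegrable (ekernel (w - 1) q).
Proof.
move=> w0 q0; apply: cintegrable_le (rkernel_integrable w0 q0).
  exact: ekernel_measurable.
by move=> t _; rewrite cmod_ekernel Re_addc Re_oppc.
Qed.

Definition euler_integral w q : R[i] := cintegral (ekernel (w - 1) q).

(** The function t^w e^(-q t) vanishes at both ends of the half-line, and
    its derivative is w t^(w-1) e^(-q t) - q t^w e^(-q t). *)
Lemma euler_integral_rec w q : 0 < complex.Re w -> 0 < complex.Re q ->
  w * euler_integral w q = q * euler_integral (w + 1) q.
Proof.
move=> w0 q0; set s := complex.Re w; set d := complex.Re q.
have i1 := ekernel_integrable w0 q0.
have i2 : cintegrable (ekernel w q).
  have := @ekernel_integrable (w + 1) q; rewrite addrK; apply => //.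
  by rewrite Re_addc addr_gt0.
pose g t := w * ekernel (w - 1) q t - q * ekernel w q t.
have dF t : 0 < t -> cderiv (ekernel w q) t (g t) by exact: is_derive_ekernel.
have ig : cintegrable g.
  by apply: cintegrableD; [|apply: cintegrableN]; exact: cintegrableZ.
have e0 n : cmod (ekernel w q (expR (- n.+1%:R))) <= expR (- (s * n.+1%:R)).
  rewrite cmod_ekernel /rkernel expRK ler_expR mulrN lerBlDr lerDl.
  by rewrite mulr_ge0 ?expR_ge0 ?ltW.
(* one more power of t is bounded, so the kernel at t = e^N is O(e^(-N)) *)
have s10 : 0 < s + 1 by rewrite addr_gt0.
have [K HK] := rkernel_bounded s10 q0.
have ey n : cmod (ekernel w q (expR n.+1%:R)) <= K * expR (- n.+1%:R).
  rewrite cmod_ekernel -/s -/d.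
  have := HK _ (expR_gt0 n.+1%:R).
  rewrite -(@ler_pM2r _ (expR (- n.+1%:R))) ?expR_gt0//.
  apply: le_trans; rewrite /rkernel !expRK -expRD ler_expR.
  by rewrite le_eqVlt; apply/orP; left; apply/eqP; ring.
have c0 : expR (- (s * n.+1%:R)) @[n --> \oo] --> (0 : R).
  have -> : (fun n : nat => expR (- (s * n.+1%:R))) =
      (fun n => expR (- s) ^+ n.+1).
    by apply/funext => n; rewrite -expRM_natl; congr expR; ring.
  rewrite (cvg_shiftS (fun n => expR (- s) ^+ n)); apply: cvg_expr.
  by rewrite ger0_norm ?expR_ge0// expR_lt1 oppr_lt0.
have cy : K * expR (- n.+1%:R) @[n --> \oo] --> (0 : R).
  rewrite -[X in _ --> X](mulr0 K); apply: cvgM; first exact: cvg_cst.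
  by rewrite (cvg_shiftS (fun n => expR (- n%:R))); exact: cvgn_expR.
have sq (h : nat -> R) (b : nat -> R) : (forall n, `|h n| <= b n) ->
    b n @[n --> \oo] --> 0 -> h n @[n --> \oo] --> 0.
  move=> hb b0; apply: (@squeeze_cvgr _ _ _ _ (fun n => - b n) b) => //.
    by apply: nearW => n; rewrite -ler_norml.
  by rewrite -[X in _ --> X]oppr0; exact: cvgN.
(* v = 1 and v = - i give the real and the imaginary part of g *)
have cgg t (v : R[i]) : 0 < t -> {for t, continuous (fun t => complex.Re (v * g t))}.
  move=> t0; rewrite (_ : (fun t => _) = (fun t =>
    complex.Re ((v * w) * ekernel (w - 1) q t) -
    complex.Re ((v * q) * ekernel w q t))).
    by apply: cvgB; exact: continuous_ekernel.
  by apply/funext => x; rewrite /g mulrBr Re_addc Re_oppc !mulrA.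
have Ig : cintegral g = 0.
  rewrite /cintegral.
  suff [-> ->] : \int[mu]_(t in Rpos) complex.Re (g t) = 0 /\
    \int[mu]_(t in Rpos) complex.Im (g t) = 0 by [].
  split.
    apply: (@improper_FTC0 _ (fun t => complex.Re (ekernel w q t))).
    - by move=> t t0; exact: (dF t t0).1.
    - move=> t t0; have := cgg t 1 t0.
      by rewrite (_ : (fun t => _) = (fun t => complex.Re (g t)))//;
        apply/funext => x; rewrite mul1r.
    - exact: ig.1.
    - by apply: sq cy => n; rewrite (le_trans (ler_Re_cmod _))// ey.
    - by apply: sq c0 => n; rewrite (le_trans (ler_Re_cmod _))// e0.
  apply: (@improper_FTC0 _ (fun t => complex.Im (ekernel w q t))).
  - by move=> t t0; exact: (dF t t0).2.
  - move=> t t0; have := cgg t (- 'i) t0.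
    rewrite (_ : (fun t => _) = (fun t => complex.Im (g t)))//.
    by apply/funext => x; rewrite Re_mulc /=; ring.
  - exact: ig.2.
  - by apply: sq cy => n; rewrite (le_trans (ler_Im_cmod _))// ey.
  - by apply: sq c0 => n; rewrite (le_trans (ler_Im_cmod _))// e0.
move: Ig; rewrite cintegralB ?cintegralZ//; try exact: cintegrableZ.
by rewrite /euler_integral addrK => /eqP; rewrite subr_eq0 => /eqP.
Qed.

(** The path u |-> q(u) = exp(z u) leads from 1 to exp z inside the right
    half-plane.  Along it exp(z w u) times the Euler integral at q(u) has the
    derivative z exp(z w u) (w I(w) - q(u) I(w + 1)), which is 0 by
    [euler_integral_rec]. *)
Lemma euler_integral_cexp w z :
  0 < complex.Re w -> `|complex.Im z| < pi / 2 ->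
  euler_integral w (cexp z) = cexp (- (w * z)) * euler_integral w 1.
Proof.
move=> w0 zI; set s := complex.Re w; set th := `|complex.Im z|.
rewrite -/th in zI; have pi0 := @pi_gt0 R.
have th0 : 0 <= th by rewrite normr_ge0.
(* the margin e keeps q(u) in the open right half-plane for u in a
   neighbourhood of [0, 1], where differentiation under the integral applies *)
pose e := (pi / 2 - th) / pi.
have e0 : 0 < e by rewrite divr_gt0// subr_gt0.
have e1 : e <= 1.
  by rewrite ler_pdivrMr// mul1r; lra.
have he : (1 + e) * th < pi / 2.
  have : e * th <= (pi / 2 - th) / 2.
    rewrite /e mulrAC -mulrA ler_pM2l ?subr_gt0// ler_pdivrMr//; lra.
  by rewrite (_ : (1 + e) * th = th + e * th); [lra|ring].
have he0 : 0 <= (1 + e) * th by rewrite mulr_ge0// addr_ge0// ltW.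
have cos0' : 0 < cos ((1 + e) * th) by apply: cos_gt0_pihalf; lra.
pose M := expR (2 * `|complex.Re z|).
pose d := expR (- (2 * `|complex.Re z|)) * cos ((1 + e) * th).
have d0 : 0 < d by rewrite mulr_gt0 ?expR_gt0.
pose q u := cexp (z * u%:C).
have uN u : - e < u < 1 + e -> `|u| <= 1 + e /\ `|u| <= 2.
  by move=> /andP[ul uu]; split; rewrite ler_norml; apply/andP; split; lra.
have ReZ u : complex.Re (z * u%:C) = complex.Re z * u.
  by rewrite Re_mulc /= mulr0 subr0.
have ImZ u : complex.Im (z * u%:C) = complex.Im z * u.
  by rewrite Im_mulc /= mulr0 add0r.
have qRe u : - e < u < 1 + e -> d <= complex.Re (q u).
  move=> /uN[u1 u2].
  have -> : complex.Re (q u) =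
      expR (complex.Re z * u) * cos (complex.Im z * u).
    by rewrite -ReZ -ImZ /q; case: (z * u%:C) => a b; rewrite cexp_def.
  rewrite ler_pM ?expR_ge0 ?(ltW cos0')//.
    rewrite ler_expR lerNl (le_trans (ler_norm _))// normrN normrM mulrC.
    by rewrite ler_wpM2r.
  rewrite -(cos_norm (_ * u)) normrM -/th mulrC.
  have h1 : `|u| * th <= (1 + e) * th by rewrite ler_wpM2r.
  have h2 : 0 <= `|u| * th by rewrite mulr_ge0.
  rewrite leNgt ltr_cos ?in_itv/= -?leNgt// ?h2/= ?he0/=; lra.
have qM u : - e < u < 1 + e -> cmod (q u) <= M.
  move=> /uN[u1 u2]; rewrite cmod_cexp ReZ ler_expR.
  by rewrite (le_trans (ler_norm _))// normrM mulrC ler_wpM2r.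
have qR u : - e < u < 1 + e -> 0 < complex.Re (q u).
  by move=> /qRe; apply: lt_le_trans.
pose B := expR (2 * cmod (z * w)).
pose p u := cexp (z * w * u%:C).
have pB u : - e < u < 1 + e -> cmod (p u) <= B.
  move=> /uN[u1 u2]; rewrite cmod_cexp Re_mulc /= mulr0 subr0 ler_expR.
  rewrite (le_trans (ler_norm _))// normrM mulrC.
  by rewrite ler_pM// ler_Re_cmod.
pose k u t := p u * ekernel (w - 1) (q u) t.
pose k' u t := z * p u *
  (w * ekernel (w - 1) (q u) t - q u * ekernel w (q u) t).
pose G t := cmod z * B * (cmod w * rkernel (s - 1) d t + M * rkernel s d t).
have i1 u : - e < u < 1 + e -> cintegrable (ekernel (w - 1) (q u)).
  by move=> /qR; exact: ekernel_integrable.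
have i2 u : - e < u < 1 + e -> cintegrable (ekernel w (q u)).
  move=> /qR q0; have := @ekernel_integrable (w + 1) (q u).
  by rewrite addrK; apply => //; rewrite Re_addc addr_gt0.
have rk v c t : d <= c -> 0 < t -> rkernel v c t <= rkernel v d t.
  by move=> dc t0; rewrite ler_expR lerD2l lerN2 ler_wpM2r// ltW.
have dk u t : 0 < t -> cderiv (k ^~ t) u (k' u t).
  move=> t0.
  have du : cderiv (fun u => u%:C) u 1%:C by exact: (cderiv_real (is_derive_id _ _)).
  have dp := cderiv_cexp (cderivZ (z * w) du).
  have dq := cderiv_cexp (cderivZ z du).
  have dekr := cderiv_cexp (cderivD (cderiv_cst ((w - 1) * (ln t)%:C) u)
     (cderivN (cderivM dq (cderiv_cst t%:C u)))).
  have := cderivM dp dekr; congr (cderiv _ _ _).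
  rewrite -/(p u) -/(q u) -/(ekernel (w - 1) (q u) t) /k' -(ekernelS w (q u) t0).
  ring.
have dJ u : - e < u < 1 + e ->
    cderiv (fun u => cintegral (k u)) u (cintegral (k' u)).
  move=> ue; apply: (@cderiv_under_integral _ k k' G u (- e) (1 + e)) => //.
  - by move=> x xe; apply: cintegrableZ; exact: i1.
  - by move=> x t _; exact: dk.
  - move=> x t xe t0; rewrite /k' /G cmodM (cmodM z).
    apply: ler_pM; rewrite ?mulr_ge0 ?cmod_ge0//.
      by apply: ler_wpM2l; [exact: cmod_ge0|exact: pB].
    apply: le_trans (cmodD _ _) _.
    rewrite (cmodN (q x * ekernel w (q x) t)); apply: lerD.
      rewrite (cmodM w) cmod_ekernel Re_addc Re_oppc.
      by apply: ler_wpM2l; [exact: cmod_ge0|exact: rk (qRe x xe) t0].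
    rewrite (cmodM (q x)) cmod_ekernel.
    apply: ler_pM; [exact: cmod_ge0|exact: expR_ge0|exact: qM|].
    exact: rk (qRe x xe) t0.
  - apply: Rpos_integrableZl; apply: Rpos_integrableD; apply: Rpos_integrableZl.
      exact: rkernel_integrable.
    have := @rkernel_integrable R (s + 1) d; rewrite addrK; apply => //.
    by rewrite addr_gt0.
have J0 u : - e < u < 1 + e -> cintegral (k' u) = 0.
  move=> ue; rewrite cintegralZ; last first.
    by apply: cintegrableD; [|apply: cintegrableN]; apply: cintegrableZ; [exact: i1|exact: i2].
  rewrite cintegralB ?cintegralZ; last 4 first.
  - exact: i2.
  - exact: i1.
  - by apply: cintegrableZ; exact: i1.
  - by apply: cintegrableZ; exact: i2.
  have := euler_integral_rec w0 (qR _ ue).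
  by rewrite /euler_integral addrK => ->; rewrite subrr mulr0.
have := @cderiv0_constant (fun u => cintegral (k u)) 0 1 ltr01.
move=> /(_ _)/wrap[].
  move=> x x01; have xe : - e < x < 1 + e by move/andP: x01 => [a b]; apply/andP; split; lra.
  by rewrite -(J0 x xe); exact: dJ.
rewrite /k !cintegralZ; last 2 first.
- by apply: i1; apply/andP; split; lra.
- by apply: i1; apply/andP; split; lra.
rewrite /p /q !mulr0 !mulr1 cexp0 mul1r -/(euler_integral w 1) => ->.
by rewrite -/(euler_integral w (cexp z)) mulrA -cexpD [z * w]mulrC addNr cexp0 mul1r.
Qed.

End EulerIntegral.

(** * Gamma on vertical lines *)

Section GammaRatio.
Variable R : realType.
Implicit Types (w q z : R[i]) (s d t u tau : R).
Local Notation mu := (@lebesgue_measure R).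
Local Notation Rpos := (`]0%R, +oo[%classic : set R).

Local Opaque cexp cmod.

Lemma cgammaE w : 0 < complex.Re w -> cgamma w = euler_integral w 1.
Proof.
move=> w0; rewrite /cgamma w0; apply: eq_cintegral => t t0.
by rewrite cpow_real// -cexpD /ekernel mul1r.
Qed.

Lemma cgammaS w : 0 < complex.Re w -> cgamma (w + 1) = w * cgamma w.
Proof.
move=> w0; rewrite !cgammaE ?Re_addc ?addr_gt0//.
by rewrite euler_integral_rec//= mul1r.
Qed.

(** Gamma at the real point s. *)
Definition rgamma s : R := \int[mu]_(t in Rpos) rkernel (s - 1) 1 t.

Lemma euler_integral_real s d :
  euler_integral s%:C d%:C = (\int[mu]_(t in Rpos) rkernel (s - 1) d t)%:C.
Proof.
rewrite /euler_integral /cintegral.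
have E t : ekernel (s%:C - 1) d%:C t = (rkernel (s - 1) d t)%:C.
  by rewrite /ekernel -[1]/(1%:C) -rmorphB -!rmorphM -rmorphB cexp_real.
congr (_ +i* _); first by under eq_Rintegral do rewrite E.
under eq_Rintegral do rewrite E /=.
by rewrite Rintegral_cst ?mul0r//; exact: measurable_Rpos.
Qed.

Lemma rgammaS s : 0 < s -> rgamma (s + 1) = s * rgamma s.
Proof.
move=> s0; have := @euler_integral_rec R s%:C 1 s0 ltr01.
rewrite -[1 in X in _ = 1 * X]/(1%:C) -rmorphD -[1]/(1%:C) !euler_integral_real.
by rewrite -!rmorphM mul1r => /complexI ->.
Qed.

(** The case of real w and q of [euler_integral_cexp]. *)
Lemma Rintegral_rkernel s d : 0 < s -> 0 < d ->
  \int[mu]_(t in Rpos) rkernel (s - 1) d t = expR (- (s * ln d)) * rgamma s.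
Proof.
move=> s0 d0; apply: complexI; rewrite -euler_integral_real.
rewrite -{1}[d]lnK ?posrE// -cexp_real euler_integral_cexp//=; last first.
  by rewrite normr0 divr_gt0// pi_gt0.
rewrite -rmorphM -rmorphN cexp_real -[X in euler_integral _ X]/(1%:C).
by rewrite euler_integral_real rmorphM.
Qed.

(** Positivity comes from the interval [1, 2], where the integrand is at
    least b. *)
Lemma rgamma_gt0 s : 0 < s -> 0 < rgamma s.
Proof.
move=> s0.
have i1 := @rkernel_integrable R s 1 s0 ltr01.
pose b : R := expR (- `|s - 1| - 2).
have bP t : 1 <= t <= 2 -> b <= rkernel (s - 1) 1 t.
  move=> /andP[t1 t2]; rewrite ler_expR mul1r lerD ?lerN2//.
  have l0 := ln_ge0 t1.
  have l1 : ln t <= 1.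
    have := @le_ln1Dx R (t - 1); rewrite (addrC 1) subrK => /(_ _) h.
    by rewrite (le_trans (h _))//; lra.
  rewrite lerNl -mulNr (le_trans (ler_norm _))// normrM normrN (ger0_norm l0).
  by rewrite -[leRHS]mulr1 ler_wpM2l.
have sub : (`[1, 2]%classic : set R) `<=` Rpos.
  by move=> t; rewrite in_Rpos /= in_itv/= => /andP[+ _]; exact: lt_le_trans.
have m12 : measurable (`[1, 2]%classic : set (measurableTypeR R)).
  exact: measurable_itv.
have h : (b%:E <= \int[mu]_(t in Rpos) (rkernel (s - 1) 1 t)%:E)%E.
  apply: (@le_trans _ _ (\int[mu]_(t in `[1%R, 2%R]) (rkernel (s - 1) 1 t)%:E)%E).
    apply: (@le_trans _ _ (\int[mu]_(t in `[1%R, 2%R]) b%:E)%E).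
      rewrite integral_cst//= lebesgue_measure_itv/= lte_fin ltr1n -EFinB.
      by rewrite -EFinM lee_fin (_ : 2 - 1 = 1) ?mulr1//; ring.
    apply: ge0_le_integral => //.
    - by move=> t _; rewrite lee_fin expR_ge0.
    - apply/measurable_EFinP; apply: measurable_funS sub _.
        exact: measurable_Rpos.
      by apply: Rpos_continuous_measurable; exact: continuous_rkernel.
  apply: ge0_subset_integral => //.
  - exact: (measurable_int mu i1).
  - by move=> t _; rewrite lee_fin expR_ge0.
have : (0 < \int[mu]_(t in Rpos) (rkernel (s - 1) 1 t)%:E)%E.
  by rewrite (lt_le_trans _ h)// lte_fin expR_gt0.
rewrite -[X in (0 < X)%E]fineK ?lte_fin//.
by apply: integrable_fin_num i1; exact: measurable_Rpos.
Qed.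

Lemma norm_sin_le t : `|sin t| <= `|t|.
Proof.
wlog t0 : t / 0 < t => [h|].
  have [t0|t0|->] := ltgtP t 0; [|exact: h|by rewrite sin0].
  by rewrite -normrN -sinN -[leRHS]normrN h// oppr_gt0.
have [] := @MVT _ (@sin R) cos 0 t t0.
  by apply: continuous_subspaceT; exact: continuous_sin.
move=> c _; rewrite sin0 !subr0 => ->; rewrite normrM -[leRHS]mul1r.
by rewrite ler_wpM2r// cos_max.
Qed.

Lemma cos_ge_quadratic t : 1 - t ^+ 2 / 2 <= cos t.
Proof.
have -> : cos t = 1 - 2 * sin (t / 2) ^+ 2.
  rewrite -[t in LHS](_ : t / 2 + t / 2 = t); last by field.
  by rewrite cosD -!expr2 cos2sin2; ring.
have := norm_sin_le (t / 2).
rewrite -ler_sqr ?nnegrE// !real_normK ?num_real//; nra.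
Qed.

(** With y = t^(1/2) the right-hand side is 4 (y - 1/y)^2, and
    |y - 1/y| >= |ln y| by exp v >= 1 + v. *)
Lemma sqr_ln_le t : 0 < t -> ln t ^+ 2 <= 4 * (t - 2 + t^-1).
Proof.
move=> t0; rewrite -[in leRHS](@lnK _ t) ?posrE// -expRN.
move: (ln t) => v {t t0}; pose y := expR (v / 2); pose x := expR (- (v / 2)).
have xy : x * y = 1 by rewrite -expRD addNr expR0.
have -> : expR v = y ^+ 2 by rewrite -expRM_natl; congr expR; field.
have -> : expR (- v) = x ^+ 2 by rewrite -expRM_natl; congr expR; field.
have hy : 1 + v / 2 <= y by exact: expR_ge1Dx.
have hx : 1 - v / 2 <= x by exact: expR_ge1Dx.
have -> : y ^+ 2 - 2 + x ^+ 2 = (y - x) ^+ 2 by rewrite sqrrB mulrC xy; ring.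
have [v0|v0] := lerP 0 v.
  have x1 : x <= 1 by rewrite expR_le1; lra.
  have : 0 <= v / 2 <= y - x by apply/andP; split; lra.
  by move=> /andP[]; nra.
have y1 : y <= 1 by rewrite expR_le1; lra.
have : 0 <= - (v / 2) <= x - y by apply/andP; split; lra.
by move=> /andP[]; nra.
Qed.

(** Let X have density t^(s-1) e^(-t) / Gamma s.  Then
    s^(-i tau) Gamma(s + i tau) / Gamma s is the mean of
    exp(i tau ln(X/s)), whose real part is at least the mean of
    1 - (tau ln(X/s))^2 / 2.  By [sqr_ln_le] the mean of ln(X/s)^2 is at most
    4 times the mean of X/s - 2 + s/X, which is 1 / (s - 1). *)
Lemma cgamma_lower_large (s tau : R) : 1 < s ->
  rgamma s * (1 - 2 * tau ^+ 2 / (s - 1)) <= cmod (cgamma (s +i* tau)).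
Proof.
move=> s1; have s0 : 0 < s by lra.
have s10 : 0 < s - 1 by lra.
rewrite cgammaE//=; set w := s +i* tau.
(* multiplication by s^(-i tau) does not change the modulus *)
pose c := cexp (- (tau * ln s)*i).
have -> : cmod (euler_integral w 1) = cmod (c * euler_integral w 1).
  by rewrite cmodM cmod_cexp /= oppr0 expR0 mul1r.
have iw : cintegrable (ekernel (w - 1) 1) by apply: ekernel_integrable => //=.
rewrite /euler_integral -cintegralZ//.
have iz := cintegrableZ c iw.
apply: le_trans (ler_Re_cmod _); apply: le_trans (ler_norm _).
have i0 := @rkernel_integrable R (s - 1) 1 s10 ltr01.
have i1 := @rkernel_integrable R s 1 s0 ltr01.
have i2 : mu.-integrable Rpos (EFin \o rkernel s 1).
  have := @rkernel_integrable R (s + 1) 1; rewrite addrK; apply => //; lra.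
(* K = 4 * tau^2 / 2 combines the constants of the cosine and logarithm bounds *)
pose K := 2 * tau ^+ 2.
have -> : rgamma s * (1 - 2 * tau ^+ 2 / (s - 1)) =
   \int[mu]_(t in Rpos) ((1 + 2 * K) * rkernel (s - 1) 1 t -
     (K / s * rkernel s 1 t + K * s * rkernel (s - 1 - 1) 1 t)).
  rewrite RintegralB; try exact: measurable_Rpos; last 2 first.
  - exact: Rpos_integrableZl.
  - by apply: Rpos_integrableD; exact: Rpos_integrableZl.
  rewrite RintegralD; try exact: measurable_Rpos; last 2 first.
  - exact: Rpos_integrableZl.
  - exact: Rpos_integrableZl.
  rewrite !RintegralZl//; try exact: measurable_Rpos.
  rewrite -/(rgamma s) -/(rgamma (s - 1)).
  have -> : \int[mu]_(t in Rpos) rkernel s 1 t = s * rgamma s.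
    by rewrite -rgammaS// /rgamma addrK.
  have -> : rgamma s = (s - 1) * rgamma (s - 1) by rewrite -rgammaS// subrK.
  by rewrite /K; field; rewrite !gt_eqF.
rewrite /cintegral /=; apply: le_Rintegral.
- exact: measurable_Rpos.
- apply: Rpos_integrableB; first exact: Rpos_integrableZl.
  by apply: Rpos_integrableD; exact: Rpos_integrableZl.
- exact: iz.1.
move=> t; rewrite in_Rpos => t0.
have -> : complex.Re (c * ekernel (w - 1) 1 t) =
    rkernel (s - 1) 1 t * cos (tau * (ln t - ln s)).
  rewrite /c /ekernel -cexpD.
  have -> : - (tau * ln s)*i + ((w - 1) * (ln t)%:C - 1 * t%:C) =
     ((s - 1) * ln t - 1 * t) +i* (tau * (ln t - ln s)).
    by apply/eqP; rewrite eq_complex /=; apply/andP; split; apply/eqP; ring.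
  by rewrite cexp_def.
have e1 : rkernel s 1 t = t * rkernel (s - 1) 1 t.
  by rewrite -[t in t * _]lnK ?posrE// -expRD; congr expR; ring.
have e2 : rkernel (s - 1 - 1) 1 t = t^-1 * rkernel (s - 1) 1 t.
  by rewrite -[t in t^-1 * _]lnK ?posrE// -expRN -expRD; congr expR; ring.
rewrite e1 e2.
have h1 := cos_ge_quadratic (tau * (ln t - ln s)).
have := sqr_ln_le (divr_gt0 t0 s0); rewrite ln_div ?posrE// invf_div => h2.
have h3 : 1 - K * (t / s - 2 + s / t) <= cos (tau * (ln t - ln s)).
  apply: le_trans h1; rewrite /K exprMn.
  by have := sqr_ge0 tau; nra.
rewrite (_ : _ - _ = rkernel (s - 1) 1 t * (1 - K * (t / s - 2 + s / t))).
  by rewrite ler_wpM2l ?expR_ge0.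
by field; rewrite !gt_eqF.
Qed.

(** Far to the right this is [cgamma_lower_large].  The functional equation
    moves it back to s >= s0 in finitely many unit steps, each of which costs
    at most the factor |s + i tau| / s <= 1 + |tau| / s0. *)
Lemma rgamma_le_cgamma (s0 tau : R) : 0 < s0 ->
  exists2 K, 0 < K &
    forall s, s0 <= s -> rgamma s <= K * cmod (cgamma (s +i* tau)).
Proof.
move=> s00.
suff H n : exists2 K, 0 < K & forall s, s0 <= s ->
    2 + 4 * tau ^+ 2 <= s + n%:R -> rgamma s <= K * cmod (cgamma (s +i* tau)).
  have [K K0 HK] := H (Num.truncn (2 + 4 * tau ^+ 2)).+1.
  exists K => // s ss; apply: HK => //.
  have := truncnS_gt (2 + 4 * tau ^+ 2); lra.
elim: n => [|n [K K0 HK]].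
  exists 2 => // s ss; rewrite addr0 => hs.
  have t20 := sqr_ge0 tau.
  have s1 : 1 < s by lra.
  have := @cgamma_lower_large s tau s1.
  have : 2^-1 <= 1 - 2 * tau ^+ 2 / (s - 1).
    rewrite lerBrDl -lerBrDr ler_pdivrMr; lra.
  have := @rgamma_gt0 s ltac:(lra); nra.
exists (K * (1 + `|tau| / s0)).
  by rewrite mulr_gt0// ltr_wpDr// divr_ge0// ltW.
move=> s ss hs.
have sp : 0 < s by lra.
have hs1 : s + n.+1%:R = s + 1 + n%:R by rewrite -(natr1 n); ring.
have := HK (s + 1) ltac:(lra); rewrite hs1 in hs => /(_ hs); rewrite rgammaS//.
have -> : (s + 1) +i* tau = (s +i* tau) + 1.
  by apply/eqP; rewrite eq_complex /= addr0 !eqxx.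
rewrite cgammaS//= cmodM => h.
have hw : cmod (s +i* tau) <= s * (1 + `|tau| / s0).
  have -> : s +i* tau = s%:C + 'i * tau%:C.
    by apply/eqP; rewrite eq_complex /=; apply/andP; split; apply/eqP; ring.
  apply: le_trans (cmodD _ _) _.
  rewrite cmodM !cmod_real cmod_sqrt /= expr0n/= add0r expr1n sqrtr1 mul1r.
  rewrite (ger0_norm (ltW sp)) mulrDr mulr1 lerD2l mulrA ler_pdivlMr//.
  by rewrite mulrC ler_wpM2r.
rewrite -(ler_pM2l sp); apply: le_trans h _.
rewrite (_ : s * _ = K * (s * (1 + `|tau| / s0) * cmod (cgamma (s +i* tau)))).
  by rewrite ler_pM2l// ler_wpM2r// cmod_ge0.
ring.
Qed.

Lemma cgamma_neq0 w : 0 < complex.Re w -> cgamma w != 0.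
Proof.
case: w => s tau /= s0; have [K K0 /(_ s (lexx _))] := rgamma_le_cgamma tau s0.
have := rgamma_gt0 s0; rewrite -cmod_gt0 => g0 h.
by rewrite -(pmulr_rgt0 _ K0) (lt_le_trans g0).
Qed.

End GammaRatio.

(** * Square partial sums and termwise integration *)

Section SquareSums.
Variable R : realType.
Implicit Types (a b : nat -> nat -> R).
Local Notation mu := (@lebesgue_measure R).
Local Notation Rpos := (`]0%R, +oo[%classic : set R).

Definition sqsum a (N : nat) : R := \sum_(m < N) \sum_(n < N) a m n.

(** For nonnegative families this is summability, stated on the partial sums
    over squares that define the sum of a double series. *)
Definition sqbounded a : Prop := exists M, forall N, sqsum a N <= M.

Lemma ler_sqsum a b N : (forall m n, a m n <= b m n) -> sqsum a N <= sqsum b N.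
Proof. by move=> ab; apply: ler_sum => m _; apply: ler_sum => n _. Qed.

Lemma sqsum_ge0 a N : (forall m n, 0 <= a m n) -> 0 <= sqsum a N.
Proof. by move=> a0; apply: sumr_ge0 => m _; apply: sumr_ge0 => n _. Qed.

Lemma sqsumD a b N : sqsum (fun m n => a m n + b m n) N = sqsum a N + sqsum b N.
Proof. by rewrite /sqsum -big_split; apply: eq_bigr => m _; rewrite -big_split. Qed.

Lemma sqsumZ (k : R) a N : sqsum (fun m n => k * a m n) N = k * sqsum a N.
Proof. by rewrite /sqsum mulr_sumr; apply: eq_bigr => m _; rewrite mulr_sumr. Qed.

Lemma sqsum_nondecreasing a : (forall m n, 0 <= a m n) ->
  nondecreasing_seq (sqsum a).
Proof.
move=> a0; apply/nondecreasing_seqP => N; rewrite /sqsum big_ord_recr /=.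
rewrite -[leLHS]addr0 lerD//; last by apply: sumr_ge0 => n _.
by apply: ler_sum => m _; rewrite big_ord_recr /= lerDl.
Qed.

Lemma sqbounded_le a b : (forall m n, a m n <= b m n) ->
  sqbounded b -> sqbounded a.
Proof. by move=> ab [M HM]; exists M => N; rewrite (le_trans (ler_sqsum N ab)). Qed.

Lemma sqboundedZ (k : R) a : 0 <= k -> sqbounded a ->
  sqbounded (fun m n => k * a m n).
Proof. by move=> k0 [M HM]; exists (k * M) => N; rewrite sqsumZ ler_wpM2l. Qed.

Lemma nonneg_sqsum_cvg a : (forall m n, 0 <= a m n) -> sqbounded a ->
  cvgn (sqsum a).
Proof.
move=> a0 [M HM]; apply: nondecreasing_is_cvgn; first exact: sqsum_nondecreasing.
by exists M => _ [N _ <-].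
Qed.

(** The sums of a + b and of b are monotone and bounded, and a is their
    difference. *)
Lemma sqsum_cvg a b : (forall m n, `|a m n| <= b m n) -> sqbounded b ->
  cvgn (sqsum a).
Proof.
move=> ab bb.
have b0 m n : 0 <= b m n by rewrite (le_trans _ (ab m n)).
have c1 : cvgn (sqsum (fun m n => a m n + b m n)).
  apply: nonneg_sqsum_cvg => [m n|].
    by have := ab m n; rewrite ler_norml => /andP[h _]; rewrite -lerBlDr sub0r.
  apply: sqbounded_le (sqboundedZ (ler0n _ 2) bb) => m n.
  by have := ler_norm (a m n); have := ab m n; lra.
have c2 : cvgn (sqsum b) by exact: nonneg_sqsum_cvg.
rewrite (_ : sqsum a = sqsum (fun m n => a m n + b m n) - sqsum b).
  exact: is_cvgB.
by apply/funext => N; rewrite fctE sqsumD addrK.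
Qed.

Lemma abs_convergent_sqbounded (c : nat -> nat -> R[i]) :
  abs_convergent c -> sqbounded (fun m n => cmod (c m n)).
Proof.
rewrite /abs_convergent => sc.
exists (fine (\esum_(k in [set: nat * nat]) `|(cmod (c k.1 k.2))%:E|)%E) => N.
have fn : (\esum_(k in [set: nat * nat]) `|(cmod (c k.1 k.2))%:E|)%E \is a fin_num.
  by rewrite -summableE.
rewrite -lee_fin fineK//; apply: esum_ge.
exists (`I_N `*` `I_N); first by split => //; exact: finite_setX.
rewrite -(pair_fsbig _ (fun m n => `|(cmod (c m n))%:E|%E))//.
rewrite -fsbig_ord /sqsum -sumEFin; apply: lee_sum => m _.
rewrite -fsbig_ord -sumEFin; apply: lee_sum => n _.
by rewrite /= lee_fin ler_norm.
Qed.

(** The square partial sums are dominated by the sum of the b m n, which is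
    integrable by monotone convergence because its partial sums have integral
    at most M. *)
Lemma termwise_integration (T b : nat -> nat -> R -> R) (M : R) :
  (forall m n, measurable_fun Rpos (T m n)) ->
  (forall m n, mu.-integrable Rpos (EFin \o b m n)) ->
  (forall m n t, 0 < t -> `|T m n t| <= b m n t) ->
  (forall t, 0 < t -> sqbounded (fun m n => b m n t)) ->
  (forall N, sqsum (fun m n => \int[mu]_(t in Rpos) b m n t) N <= M) ->
  mu.-integrable Rpos (EFin \o (fun t => limn (sqsum (fun m n => T m n t)))) /\
  sqsum (fun m n => \int[mu]_(t in Rpos) T m n t) @ \oo -->
    \int[mu]_(t in Rpos) limn (sqsum (fun m n => T m n t)).
Proof.
move=> mT ib Tb bb bM.
have mR := @measurable_Rpos R.
have iT m n : mu.-integrable Rpos (EFin \o T m n).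
  by apply: Rpos_le_integrable (ib m n) => // t t0; exact: Tb.
have b0 m n t : 0 < t -> 0 <= b m n t.
  by move=> t0; rewrite (le_trans _ (Tb m n t t0)).
(* finite sums commute with the integral *)
have sqi (U : nat -> nat -> R -> R) N :
    (forall m n, mu.-integrable Rpos (EFin \o U m n)) ->
    mu.-integrable Rpos (EFin \o (fun t => sqsum (fun m n => U m n t) N)) /\
    \int[mu]_(t in Rpos) sqsum (fun m n => U m n t) N =
    sqsum (fun m n => \int[mu]_(t in Rpos) U m n t) N.
  move=> iU.
  have S (V : nat -> R -> R) k : (forall n, mu.-integrable Rpos (EFin \o V n)) ->
      mu.-integrable Rpos (EFin \o (fun t => \sum_(n < k) V n t)) /\
      \int[mu]_(t in Rpos) \sum_(n < k) V n t =
        \sum_(n < k) \int[mu]_(t in Rpos) V n t.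
    move=> iV; elim: k => [|k [ik ek]].
      split.
        apply: eq_integrable (Rpos_integrableZl 0 (ib 0%N 0%N)) => // t _.
        by rewrite /= big_ord0 mul0r.
      under eq_Rintegral do rewrite big_ord0.
      by rewrite big_ord0 Rintegral_cst// mul0r.
    split.
      apply: eq_integrable (Rpos_integrableD ik (iV k)) => // t _ /=.
      by rewrite big_ord_recr.
    under eq_Rintegral do rewrite big_ord_recr /=.
    by rewrite RintegralD// big_ord_recr /= ek.
  have h m := S (U m) N (iU m).
  have [h1 h2] := S (fun m t => \sum_(n < N) U m n t) N (fun m => (h m).1).
  by split => //; rewrite h2; apply: eq_bigr => m _; rewrite (h m).2.
pose g t := limn (sqsum (fun m n => b m n t)).
have cb t : 0 < t -> cvgn (sqsum (fun m n => b m n t)).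
  by move=> t0; apply: nonneg_sqsum_cvg (bb t t0) => m n; exact: b0.
have ndb t : 0 < t -> nondecreasing_seq (sqsum (fun m n => b m n t)).
  by move=> t0; apply: sqsum_nondecreasing => m n; exact: b0.
have mb N : measurable_fun Rpos (fun t => sqsum (fun m n => b m n t) N).
  apply/measurable_EFinP; exact: (measurable_int mu (sqi b N ib).1).
have mg : measurable_fun Rpos g.
  by apply: measurable_fun_cvg mb _ => t; rewrite in_Rpos; exact: cb.
have ig : mu.-integrable Rpos (EFin \o g).
  apply: Rpos_integrable_fin => //.
    move=> t t0; apply: limr_ge; first exact: cb.
    by apply: nearW => N; apply: sqsum_ge0 => m n; exact: b0.
  apply: (@le_lt_trans _ _ M%:E); last exact: ltry.
  have mbE N : measurable_fun Rpos (fun t => (sqsum (fun m n => b m n t) N)%:E).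
    exact/measurable_EFinP.
  have b0E N t : Rpos t -> (0 <= (sqsum (fun m n => b m n t) N)%:E)%E.
    by rewrite in_Rpos => t0; rewrite lee_fin sqsum_ge0// => m n; exact: b0.
  have ndE t : Rpos t ->
      nondecreasing_seq (fun N => (sqsum (fun m n => b m n t) N)%:E).
    by rewrite in_Rpos => t0 p q pq; rewrite lee_fin; exact: ndb.
  have cv := @cvg_monotone_convergence _ _ R mu Rpos mR _ mbE b0E ndE.
  rewrite (_ : (\int[mu]_(t in Rpos) (g t)%:E)%E =
      limn (fun N => \int[mu]_(t in Rpos) (sqsum (fun m n => b m n t) N)%:E)%E); last first.
    rewrite (cvg_lim _ cv)//; apply: eq_integral => t; rewrite inE in_Rpos => t0.
    by rewrite EFin_lim//; exact: cb.
  apply: lime_le; first exact: (cvgP _ cv).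
  apply: nearW => N; have [i1 e1] := sqi b N ib.
  rewrite -[leLHS]fineK; last by apply: integrable_fin_num i1.
  by rewrite lee_fin -/(Rintegral _ _ _) e1.
have cT t : 0 < t -> cvgn (sqsum (fun m n => T m n t)).
  by move=> t0; apply: sqsum_cvg (bb t t0) => m n; exact: Tb.
have mST N : measurable_fun Rpos (fun t => sqsum (fun m n => T m n t) N).
  apply/measurable_EFinP; exact: (measurable_int mu (sqi T N iT).1).
have mL : measurable_fun Rpos (fun t => limn (sqsum (fun m n => T m n t))).
  by apply: measurable_fun_cvg mST _ => t; rewrite in_Rpos; exact: cT.
have [] := @dominated_convergence _ _ R mu Rpos mR
  (fun N t => (sqsum (fun m n => T m n t) N)%:E)
  (fun t => (limn (sqsum (fun m n => T m n t)))%:E) (EFin \o g).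
- by move=> N; apply/measurable_EFinP; exact: mST.
- by apply/measurable_EFinP; exact: mL.
- apply: aeW => t; rewrite in_Rpos => t0.
  by apply: cvg_EFin; [exact: nearW|exact: cT].
- exact: ig.
- apply: aeW => t N; rewrite in_Rpos => t0; rewrite lee_fin.
  apply: le_trans (nondecreasing_cvgn_le (ndb t t0) (cb t t0) N).
  rewrite (le_trans (ler_norm_sum _ _ _))//; apply: ler_sum => m _.
  by rewrite (le_trans (ler_norm_sum _ _ _))//; apply: ler_sum => n _; exact: Tb.
move=> iL _ cL; split; first exact: iL.
have := fine_cvg (_ : (fun N => \int[mu]_(t in Rpos) (sqsum (fun m n => T m n t) N)%:E)%E @ \oo -->
   (\int[mu]_(t in Rpos) limn (sqsum (fun m n => T m n t)))%:E).
rewrite (_ : fine \o _ = sqsum (fun m n => \int[mu]_(t in Rpos) T m n t)).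
  apply; rewrite fineK//; exact: integrable_fin_num iL.
by apply/funext => N; rewrite -(sqi T N iT).2.
Qed.

End SquareSums.

(** * Termwise Laplace transform *)

Section TermwiseLaplace.
Variable R : realType.
Implicit Types (A : nat -> nat -> R[i]) (q w d : R[i]).
Local Notation mu := (@lebesgue_measure R).
Local Notation Rpos := (`]0%R, +oo[%classic : set R).

Local Opaque cexp cmod cgamma clog.

Lemma double_seriesE A :
  double_series A = limn (sqsum (fun m n => complex.Re (A m n))) +i*
                    limn (sqsum (fun m n => complex.Im (A m n))).
Proof. by []. Qed.

Lemma eq_double_series A B : (forall m n, A m n = B m n) ->
  double_series A = double_series B.
Proof.
by move=> AB; congr double_series; apply/funext => m; apply/funext => n.
Qed.

Lemma double_series_Re_cvg A : sqbounded (fun m n => cmod (A m n)) ->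
  cvgn (sqsum (fun m n => complex.Re (A m n))).
Proof. by apply: sqsum_cvg => m n; exact: ler_Re_cmod. Qed.

Lemma double_series_Im_cvg A : sqbounded (fun m n => cmod (A m n)) ->
  cvgn (sqsum (fun m n => complex.Im (A m n))).
Proof. by apply: sqsum_cvg => m n; exact: ler_Im_cmod. Qed.

Lemma double_seriesZ c A : sqbounded (fun m n => cmod (A m n)) ->
  double_series (fun m n => c * A m n) = c * double_series A.
Proof.
move=> bA; have cR := double_series_Re_cvg bA; have cI := double_series_Im_cvg bA.
rewrite !double_seriesE; apply/eqP; rewrite eq_complex Re_mulc Im_mulc /=.
apply/andP; split; apply/eqP; apply/cvg_lim => //.
  rewrite (_ : sqsum _ = (fun N =>
    complex.Re c * sqsum (fun m n => complex.Re (A m n)) N +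
    - complex.Im c * sqsum (fun m n => complex.Im (A m n)) N)).
    rewrite -mulNr; apply: cvgD; apply: cvgM; by [exact: cvg_cst|exact: cR|exact: cI].
  apply/funext => N; rewrite -!sqsumZ -sqsumD; congr (sqsum _ N).
  by apply/funext => m; apply/funext => n; rewrite Re_mulc mulNr.
rewrite (_ : sqsum _ = (fun N =>
  complex.Re c * sqsum (fun m n => complex.Im (A m n)) N +
  complex.Im c * sqsum (fun m n => complex.Re (A m n)) N)).
  by apply: cvgD; apply: cvgM; by [exact: cvg_cst|exact: cR|exact: cI].
apply/funext => N; rewrite -!sqsumZ -sqsumD; congr (sqsum _ N).
by apply/funext => m; apply/funext => n; rewrite Im_mulc.
Qed.

Lemma termwise_cintegration (T : nat -> nat -> R -> R[i])
    (b : nat -> nat -> R -> R) (M : R) :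
  (forall m n, cmeasurable (T m n)) ->
  (forall m n, mu.-integrable Rpos (EFin \o b m n)) ->
  (forall m n t, 0 < t -> cmod (T m n t) <= b m n t) ->
  (forall t, 0 < t -> sqbounded (fun m n => b m n t)) ->
  (forall N, sqsum (fun m n => \int[mu]_(t in Rpos) b m n t) N <= M) ->
  cintegrable (fun t => double_series (fun m n => T m n t)) /\
  cintegral (fun t => double_series (fun m n => T m n t)) =
    double_series (fun m n => cintegral (T m n)).
Proof.
move=> mT ib Tb bb bM.
have [i1 c1] := termwise_integration (fun m n => (mT m n).1) ib
  (fun m n t t0 => le_trans (ler_Re_cmod _) (Tb m n t t0)) bb bM.
have [i2 c2] := termwise_integration (fun m n => (mT m n).2) ib
  (fun m n t t0 => le_trans (ler_Im_cmod _) (Tb m n t t0)) bb bM.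
split; first by split.
by rewrite double_seriesE /= (cvg_lim _ c1)// (cvg_lim _ c2).
Qed.

(** The modulus of the term of index (m, n) integrates to
    |A m n| Gamma(s + e) / |Gamma(d + e)| r^(-s-e), where s = Re d and
    r = Re q; by [rgamma_le_cgamma] this is at most a constant times
    |A m n| r^(-e). *)
Lemma laplace_termwise d (e : nat -> nat -> R) A q :
  0 < complex.Re d -> (forall m n, 0 <= e m n) -> 0 < complex.Re q ->
  (forall t, 0 < t -> sqbounded (fun m n =>
     cmod (A m n / cgamma (d + (e m n)%:C)) * expR (e m n * ln t))) ->
  sqbounded (fun m n => cmod (A m n) * expR (- (e m n * ln (complex.Re q)))) ->
  let h t := double_series (fun m n => A m n / cgamma (d + (e m n)%:C) *
    cexp ((d + (e m n)%:C - 1) * (ln t)%:C)) in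
  laplace_exists h q /\
  laplace h q =
    double_series (fun m n => A m n * cexp (- ((d + (e m n)%:C) * clog q))).
Proof.
move=> d0 e0 q0 bD bE h; set s := complex.Re d; set r := complex.Re q.
have w0 m n : 0 < complex.Re (d + (e m n)%:C).
  by rewrite Re_addc /= ltr_wpDr.
pose B m n := A m n / cgamma (d + (e m n)%:C).
pose T m n t := B m n * ekernel (d + (e m n)%:C - 1) q t.
pose b m n t := cmod (B m n) * rkernel (s + e m n - 1) r t.
have Tb m n t : cmod (T m n t) = b m n t.
  by rewrite cmodM cmod_ekernel !Re_addc Re_oppc.
have ib m n : mu.-integrable Rpos (EFin \o b m n).
  by apply: Rpos_integrableZl; apply: rkernel_integrable => //; rewrite ltr_wpDr.
have hT t : 0 < t -> laplace_kernel h q t = double_series (fun m n => T m n t).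
  move=> t0; rewrite /laplace_kernel /h mulrC -double_seriesZ.
    apply: eq_double_series => m n.
    rewrite mulrCA -cexpD /T /ekernel /B; congr (_ * cexp _); ring.
  have := sqboundedZ (expR_ge0 ((s - 1) * ln t)) (bD t t0).
  apply: sqbounded_le => m n; rewrite cmodM cmod_cexp mulrCA -expRD.
  rewrite le_eqVlt; apply/orP; left; apply/eqP; congr (_ * expR _).
  by rewrite Re_mulc /= mulr0 subr0 !Re_addc Re_oppc /= -/s; ring.
have bb t : 0 < t -> sqbounded (fun m n => b m n t).
  move=> t0.
  have := sqboundedZ (expR_ge0 ((s - 1) * ln t - r * t)) (bD t t0).
  apply: sqbounded_le => m n; rewrite /b mulrCA -expRD.
  rewrite le_eqVlt; apply/orP; left; apply/eqP; congr (_ * expR _); ring.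
have [K K0 HK] := rgamma_le_cgamma (complex.Im d) d0.
have := sqboundedZ (mulr_ge0 (ltW K0) (expR_ge0 (- (s * ln r)))) bE.
move=> [M HM].
have bM N : sqsum (fun m n => \int[mu]_(t in Rpos) b m n t) N <= M.
  apply: le_trans (HM N); apply: ler_sqsum => m n.
  have se : 0 < s + e m n by rewrite ltr_wpDr.
  rewrite RintegralZl; [|exact: measurable_Rpos|exact: rkernel_integrable].
  rewrite Rintegral_rkernel// /B cmodM cmodV.
  have := HK (s + e m n); rewrite lerDl e0 => /(_ isT).
  have -> : (s + e m n) +i* complex.Im d = d + (e m n)%:C.
    by rewrite /s; case: (d) => ? ? /=; apply/eqP; rewrite eq_complex /= addr0 !eqxx.
  have g0 : 0 < cmod (cgamma (d + (e m n)%:C)).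
    by rewrite cmod_gt0; exact: cgamma_neq0.
  rewrite -ler_pdivrMr// => hK.
  have -> : expR (- ((s + e m n) * ln r)) =
      expR (- (s * ln r)) * expR (- (e m n * ln r)).
    by rewrite -expRD; congr expR; ring.
  set X := expR (- (s * ln r)); set Y := expR (- (e m n * ln r)).
  have X0 : 0 <= X * Y by rewrite mulr_ge0 ?expR_ge0.
  have C0 := cmod_ge0 (A m n).
  rewrite (_ : _ * _ = (rgamma (s + e m n) / cmod (cgamma (d + (e m n)%:C))) *
    (cmod (A m n) * (X * Y))); last by ring.
  rewrite (_ : K * X * _ = K * (cmod (A m n) * (X * Y))); last by ring.
  by rewrite ler_wpM2r// mulr_ge0.
have mT m n : cmeasurable (T m n).
  by apply: cmeasurableM; [exact: cmeasurable_cst|exact: ekernel_measurable].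
have Tb' m n t : 0 < t -> cmod (T m n t) <= b m n t by rewrite Tb.
have [iT eT] := termwise_cintegration mT ib Tb' bb bM.
split.
  by apply: eq_cintegrable iT => t t0; rewrite hT.
rewrite /laplace (eq_cintegral hT) eT; apply: eq_double_series => m n.
rewrite /T cintegralZ; last exact: ekernel_integrable.
rewrite -/(euler_integral (d + (e m n)%:C) q) /B.
have [eq1 eq2] := clog_right q0.
rewrite -[in LHS]eq1 euler_integral_cexp// -cgammaE//.
by rewrite [cexp _ * _]mulrC mulrA divfK// cgamma_neq0.
Qed.

End TermwiseLaplace.

(** * Uniqueness from factorial bounds on derivatives *)

Section QuasiAnalytic.
Variable R : realType.
Implicit Types (f : nat -> R -> R) (r s t : R).

Lemma is_derive_taylor_power (B b : R) n r :
  is_derive r 1 (fun r => B * (b - r) ^+ n.+1 / n.+1`!%:R)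
    (- (B * (b - r) ^+ n / n`!%:R)).
Proof.
have d0 : is_derive r 1 (cst b - id) (0 - 1) by apply: is_deriveB.
have d1 : is_derive r 1 ((cst b - id) ^+ n.+1)
    ((n.+1%:R * (cst b - id) r ^+ n) *: (0 - 1)) by exact: is_deriveX.
have d2 := is_deriveZ (B / n.+1`!%:R) d1.
have E : (B / n.+1`!%:R) \*: ((cst b - id) ^+ n.+1) =
    (fun r => B * (b - r) ^+ n.+1 / n.+1`!%:R).
  apply/funext => x; rewrite /GRing.scale/= mulrAC.
  congr (_ * _ * _); elim: (n.+1) => [|k IH]; first by rewrite !expr0.
  by rewrite !exprS -IH.
rewrite E in d2; apply: (is_derive_eq d2).
rewrite /GRing.scale/= factS natrM sub0r.
have k0 : n.+1%:R != 0 :> R by rewrite pnatr_eq0.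
have f0 : n`!%:R != 0 :> R by rewrite pnatr_eq0 -lt0n fact_gt0.
have -> : (cst b - id) r = b - r by [].
by move: k0 f0; move: (n.+1%:R : R) (n`!%:R : R) => p q k0 f0;
  field; rewrite ?k0 ?f0.
Qed.

(** Here f j is the j-th derivative of f 0.  A bound on f 1 of this shape is
    integrated from r to b, where f 0 vanishes. *)
Lemma taylor_zero_bound f (a b B : R) n :
  (forall j r, a <= r <= b -> is_derive r 1 (f j) (f j.+1 r)) ->
  (forall j, f j b = 0) ->
  (forall r, a <= r <= b -> `|f n r| <= B) ->
  forall r, a <= r <= b -> `|f 0%N r| <= B * (b - r) ^+ n / n`!%:R.
Proof.
elim: n f => [|n IH] f df fb fB r rab.
  by rewrite expr0 mulr1 fact0 divr1; exact: fB.
have H1 := IH (fun j => f j.+1) (fun j => df j.+1) (fun j => fb j.+1) fB.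
have main (e : R) : `|e| = 1 ->
    e * f 0%N r <= B * (b - r) ^+ n.+1 / n.+1`!%:R.
  move=> e1.
  pose h x := B * (b - x) ^+ n.+1 / n.+1`!%:R - e * f 0%N x.
  have dh x : a <= x <= b ->
      is_derive x 1 h (- (B * (b - x) ^+ n / n`!%:R) - e * f 1%N x).
    move=> xab; have := df 0%N x xab => d0.
    exact: (is_deriveB (is_derive_taylor_power B b n x) (is_deriveZ e d0)).
  have : h b <= h r.
    have [ar rb] := andP rab.
    apply: (@ler0_derive1_nincr _ h r b) => //.
    - move=> x; rewrite in_itv/= => /andP[rx xb].
      by case: (dh x) => //; rewrite (le_trans ar)//= ltW.
    - move=> x; rewrite in_itv/= => /andP[rx xb].
      have xab : a <= x <= b by rewrite (le_trans ar)//= ltW.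
      rewrite derive1E (@derive_val _ _ _ _ _ _ _ (dh x xab)).
      rewrite lerBlDr add0r.
      have := H1 x xab; rewrite -[`|f 1%N x|]mul1r -e1 -normrM ler_norml.
      by move=> /andP[].
    - apply: derivable_within_continuous => x; rewrite in_itv/= => /andP[rx xb].
      by case: (dh x) => //; rewrite (le_trans ar).
  rewrite /h fb mulr0 subr0 subrr expr0n/= mulr0 mul0r.
  by rewrite subr_ge0.
rewrite ler_norml lerNl -mulN1r main ?normrN1//=.
by rewrite -[f 0%N r]mul1r main// normr1.
Qed.

Variables (f : nat -> R -> R) (M rho : R).
Hypothesis rho0 : 0 < rho.
Hypothesis df : forall j s, 0 < s -> is_derive s 1 (f j) (f j.+1 s).
Hypothesis fM : forall j s, 0 < s -> `|f j s| <= M * j`!%:R / (rho * s) ^+ j.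

Lemma derivatives_vanish S : 0 < S -> (forall s, S < s -> f 0%N s = 0) ->
  forall j s, S < s -> f j s = 0.
Proof.
move=> S0 f0; elim=> [//|j IH] s Ss.
have [_ <-] := df j (lt_trans S0 Ss).
rewrite (@near_eq_derive _ _ _ (f j) (cst 0))//; last first.
  near=> x; apply: IH; near: x; exact: lt_nbhsr.
by rewrite derive_cst.
Unshelve. all: by end_near. Qed.

(** At a point S1 slightly larger than S all derivatives vanish.  Taylor's
    formula from S1 down to s has a remainder at most M x^n with
    x = (S1 - s) / (rho s), which tends to 0 because S1 - s < rho s; the
    factor 1 + rho / 2 leaves room for S1. *)
Lemma vanishing_step S : 0 < S -> (forall s, S < s -> f 0%N s = 0) ->
  forall s, S < s * (1 + rho / 2) -> f 0%N s = 0.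
Proof.
move=> S0 f0 s hs.
have k0 : 0 < 1 + rho / 2 by rewrite addr_gt0// divr_gt0.
have s0 : 0 < s by rewrite -(pmulr_lgt0 _ k0) (lt_trans S0).
have [Ss|sS] := ltP S s; first exact: f0.
(* any point strictly between S and s (1 + rho / 2) serves as centre *)
pose S1 := (S + s * (1 + rho / 2)) / 2.
have SS1 : S < S1 by rewrite /S1; lra.
have S1s : S1 < s * (1 + rho / 2) by rewrite /S1; lra.
pose x := (S1 - s) / (rho * s).
have rs : 0 < rho * s by rewrite mulr_gt0.
have x0 : 0 <= x by rewrite divr_ge0 ?(ltW rs)//; lra.
have x1 : x < 1.
  by rewrite ltr_pdivrMr// mul1r; move: S1s; rewrite mulrDr mulr1; lra.
have fx n : `|f 0%N s| <= M * x ^+ n.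
  have -> : M * x ^+ n = M * n`!%:R / (rho * s) ^+ n * (S1 - s) ^+ n / n`!%:R.
    have fn0 : n`!%:R != 0 :> R by rewrite pnatr_eq0 -lt0n fact_gt0.
    rewrite /x expr_div_n; field; rewrite fn0 expf_neq0//.
    by rewrite gt_eqF.
  apply: (@taylor_zero_bound f s S1) => //.
  - by move=> j r /andP[sr _]; apply: df; exact: lt_le_trans sr.
  - by move=> j; exact: (derivatives_vanish S0 f0).
  - move=> r /andP[sr _]; have r0 := lt_le_trans s0 sr.
    apply: le_trans (fM n r0) _.
    have M0 : 0 <= M * n`!%:R.
      have := fM n r0; rewrite ler_pdivlMr ?exprn_gt0 ?mulr_gt0//.
      apply: le_trans; apply: mulr_ge0; first exact: normr_ge0.
      by rewrite exprn_ge0// ltW// mulr_gt0.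
    rewrite ler_wpM2l// lef_pV2 ?posrE ?exprn_gt0 ?mulr_gt0//.
    apply: lerXn2r; rewrite ?nnegrE ?ler_pM2l//.
      exact: ltW.
    by rewrite ltW// mulr_gt0.
  - by apply/andP; split; lra.
have c0 : M * x ^+ n @[n --> \oo] --> 0.
  rewrite -[X in _ --> X](mulr0 M); apply: cvgM; first exact: cvg_cst.
  by apply: cvg_expr; rewrite ger0_norm.
apply/eqP; rewrite -normr_le0 -(cvg_lim _ c0)//.
by apply: limr_ge; [exact: (cvgP _ c0)|exact: nearW].
Qed.

(** Each step divides the threshold by the constant 1 + rho / 2, so that
    every s > 0 is reached. *)
Lemma vanishing_continuation S : 0 < S -> (forall s, S < s -> f 0%N s = 0) ->
  forall s, 0 < s -> f 0%N s = 0.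
Proof.
move=> S0 f0 s s0; set k := 1 + rho / 2.
have k1 : 1 <= k by rewrite lerDl divr_ge0// ltW.
have k0 : 0 < k by rewrite (lt_le_trans _ k1).
have H n : forall s, S < s * k ^+ n -> f 0%N s = 0.
  elim: n => [|n IH] r; first by rewrite expr0 mulr1; exact: f0.
  rewrite exprSr mulrA => hr; apply: (@vanishing_step (S / k ^+ n)).
  - by rewrite divr_gt0// exprn_gt0.
  - by move=> y; rewrite ltr_pdivrMr ?exprn_gt0//; exact: IH.
  - by rewrite ltr_pdivrMr ?exprn_gt0// mulrAC.
have bern n : 1 + n%:R * (rho / 2) <= k ^+ n.
  elim: n => [|n IH]; first by rewrite mul0r addr0 expr0.
  rewrite exprS -natr1.
  have := ler_wpM2l (ltW k0) IH; apply: le_trans; rewrite /k.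
  have : 0 <= n%:R * (rho / 2) ^+ 2 by rewrite mulr_ge0 ?sqr_ge0.
  lra.
(* by Bernoulli's inequality n steps divide S by at least 1 + n rho / 2 *)
pose n := (Num.truncn (S / s / (rho / 2))).+1.
apply: (H n); rewrite -ltr_pdivrMl//.
apply: lt_le_trans (bern n); rewrite mulrC.
have : S / s / (rho / 2) < n%:R by exact: truncnS_gt.
by rewrite ltr_pdivrMr ?divr_gt0//; lra.
Qed.

End QuasiAnalytic.

(** * Laplace integrals along a ray *)

Section LaplaceContinuation.
Variable R : realType.
Implicit Types (u v : R -> R[i]) (c z : R[i]) (s t : R).
Local Notation mu := (@lebesgue_measure R).
Local Notation Rpos := (`]0%R, +oo[%classic : set R).

Local Opaque cexp cmod.

(** The j-th derivative in s of v(t) e^(- c t s). *)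
Definition laplace_integrand v c (j : nat) s t : R[i] :=
  v t * (- (c * t%:C)) ^+ j * cexp (- (c * t%:C) * s%:C).

Lemma power_exp_bound x (j : nat) : 0 <= x -> x ^+ j * expR (- x) <= j`!%:R :> R.
Proof.
move=> x0; rewrite expRN ler_pdivrMr ?expR_gt0//.
case: j => [|j]; first by rewrite expr0 fact0 mul1r -expR0 ler_expR.
have := expR_ge1Dxn j x0.
have f0 : 0 < (j.+1)`!%:R :> R by rewrite ltr0n fact_gt0.
move=> h; have : x ^+ j.+1 / (j.+1)`!%:R <= expR x by lra.
by rewrite ler_pdivrMr// mulrC.
Qed.

Section Integrand.
Variables (v : R -> R[i]) (c : R[i]).
Hypothesis iv : cintegrable v.
Hypothesis c0 : 0 < complex.Re c.
Hypothesis c1 : cmod c <= 1.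
Local Notation rho := (complex.Re c).

Lemma cmod_laplace_integrand j s t : 0 < t -> 
  cmod (laplace_integrand v c j s t) =
    cmod (v t) * (cmod c * t) ^+ j * expR (- (rho * s * t)).
Proof.
move=> t0; rewrite cmodM cmodM cmodX cmodN cmodM cmod_real (gtr0_norm t0).
rewrite cmod_cexp; congr (_ * expR _).
by rewrite !(Re_mulc, Re_oppc, Im_oppc, Im_mulc) /=; ring.
Qed.

(** The elementary bound x^j e^(-x) <= j! at x = Re c * s0 * t. *)
Lemma laplace_integrand_le j s0 s t : 0 < s0 -> s0 <= s -> 0 < t ->
  cmod (laplace_integrand v c j s t) <= j`!%:R / (rho * s0) ^+ j * cmod (v t).
Proof.
move=> s00 s0s t0; rewrite cmod_laplace_integrand// -mulrA mulrC.
apply: ler_wpM2r; first exact: cmod_ge0.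
have rs : 0 < rho * s0 by rewrite mulr_gt0.
apply: (@le_trans _ _ (t ^+ j * expR (- (rho * s0 * t)))).
  apply: ler_pM; rewrite ?expR_ge0 ?exprn_ge0 ?mulr_ge0 ?cmod_ge0 ?(ltW t0)//.
    rewrite lerXn2r ?nnegrE ?mulr_ge0 ?cmod_ge0 ?(ltW t0)//.
    by rewrite -[leRHS]mul1r ler_wpM2r// ltW.
  by rewrite ler_expR lerN2 -!mulrA ler_wpM2l ?(ltW c0)// ler_wpM2r// ltW.
rewrite ler_pdivlMr ?exprn_gt0// mulrAC -exprMn mulrC [t * _]mulrC.
by rewrite mulrC power_exp_bound// mulr_ge0 ?ltW.
Qed.

Lemma laplace_integrand_measurable j s : cmeasurable (laplace_integrand v c j s).
Proof.
have mv := cintegrable_measurable iv.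
have dl t : cderiv (fun t => t%:C) t 1%:C.
  exact: (cderiv_real (is_derive_id _ _)).
have mc : cmeasurable (fun t => - (c * t%:C)).
  by apply: cderiv_measurable => t _; apply: cderivN; apply: cderivZ; exact: dl.
apply: cmeasurableM.
  apply: cmeasurableM => //; elim: j => [|j IH]; first exact: cmeasurable_cst.
  rewrite (_ : (fun t => _) = (fun t => - (c * t%:C) * (- (c * t%:C)) ^+ j)).
    exact: cmeasurableM.
  by apply/funext => t; rewrite exprS.
apply: cderiv_measurable => t _; apply: cderiv_cexp.
apply: cderivM; last exact: cderiv_cst.
by apply: cderivN; apply: cderivZ; exact: dl.
Qed.

Lemma laplace_integrand_integrable j s : 0 < s ->
  cintegrable (laplace_integrand v c j s).
Proof.
move=> s0; apply: cintegrable_le (Rpos_integrableZl (j`!%:R / (rho * s) ^+ j)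
  (cintegrable_cmod iv)); first exact: laplace_integrand_measurable.
by move=> t t0; exact: laplace_integrand_le.
Qed.

Lemma laplace_integrand_derive j s : 0 < s ->
  cderiv (fun s => cintegral (laplace_integrand v c j s)) s
    (cintegral (laplace_integrand v c j.+1 s)).
Proof.
move=> s0.
apply: (@cderiv_under_integral _ (laplace_integrand v c j)
  (laplace_integrand v c j.+1)
  (fun t => j.+1`!%:R / (rho * (s / 2)) ^+ j.+1 * cmod (v t)) s (s / 2) (s + 1)).
- by apply/andP; split; lra.
- by move=> x /andP[sx _]; apply: laplace_integrand_integrable; lra.
- move=> x t _ t0.
  have di : cderiv (fun x => x%:C) x 1%:C by exact: (cderiv_real (is_derive_id _ _)).
  have := cderivZ (v t * (- (c * t%:C)) ^+ j)
    (cderiv_cexp (cderivZ (- (c * t%:C)) di)).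
  congr (cderiv _ _ _); rewrite /laplace_integrand exprS; ring.
- by move=> x t /andP[sx _] t0; apply: laplace_integrand_le => //; lra.
- by apply: Rpos_integrableZl; exact: cintegrable_cmod.
Qed.

Lemma laplace_integrand_bound j s : 0 < s ->
  let K := \int[mu]_(t in Rpos) cmod (v t) in
  `|complex.Re (cintegral (laplace_integrand v c j s))| <= K * j`!%:R / (rho * s) ^+ j /\
  `|complex.Im (cintegral (laplace_integrand v c j s))| <= K * j`!%:R / (rho * s) ^+ j.
Proof.
move=> s0 K; have [i1 i2] := laplace_integrand_integrable j s0.
have ic := cintegrable_cmod iv.
have E : K * j`!%:R / (rho * s) ^+ j =
    \int[mu]_(t in Rpos) (j`!%:R / (rho * s) ^+ j * cmod (v t)).
  rewrite RintegralZl; [|exact: measurable_Rpos|exact: ic].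
  rewrite -/K; ring.
have main (g : R -> R) : mu.-integrable Rpos (EFin \o g) ->
   (forall t, 0 < t -> `|g t| <= cmod (laplace_integrand v c j s t)) ->
   `|\int[mu]_(t in Rpos) g t| <= K * j`!%:R / (rho * s) ^+ j.
  move=> ig gle; apply: le_trans (le_normr_Rintegral _ ig) _.
    exact: measurable_Rpos.
  rewrite E; apply: le_Rintegral.
  - exact: measurable_Rpos.
  - exact: integrable_norm.
  - exact: Rpos_integrableZl.
  - move=> t; rewrite in_Rpos => t0; apply: le_trans (gle t t0) _.
    exact: laplace_integrand_le.
by split => /=; apply: main => // t t0; [exact: ler_Re_cmod|exact: ler_Im_cmod].
Qed.

Lemma cvg_laplace_integrand0 :
  (fun n => complex.Re (cintegral (laplace_integrand v c 0 n.+1%:R^-1))) @ \oo -->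
    complex.Re (cintegral v) /\
  (fun n => complex.Im (cintegral (laplace_integrand v c 0 n.+1%:R^-1))) @ \oo -->
    complex.Im (cintegral v).
Proof.
have mv := cintegrable_measurable iv.
have ic := cintegrable_cmod iv.
have main (p : R[i] -> R) :
    (forall n, measurable_fun Rpos (fun t => p (laplace_integrand v c 0 n.+1%:R^-1 t))) ->
    measurable_fun Rpos (fun t => p (v t)) ->
    (forall z, `|p z| <= cmod z) ->
    (forall t, {for 0, continuous (fun s => p (laplace_integrand v c 0 s t))}) ->
    (fun n => \int[mu]_(t in Rpos) p (laplace_integrand v c 0 n.+1%:R^-1 t)) @ \oo -->
      \int[mu]_(t in Rpos) p (v t).
  move=> mp mpv ple pc.
  have li0 t : laplace_integrand v c 0 0 t = v t.
    by rewrite /laplace_integrand expr0 mulr1 mulr0 cexp0 mulr1.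
  have [] := @dominated_convergence _ _ R mu Rpos (@measurable_Rpos R)
    (fun n t => (p (laplace_integrand v c 0 n.+1%:R^-1 t))%:E)
    (fun t => (p (v t))%:E) (EFin \o (fun t => cmod (v t))).
  - by move=> n; apply/measurable_EFinP; exact: mp.
  - by apply/measurable_EFinP.
  - apply: aeW => t _; apply: cvg_EFin; first exact: nearW.
    rewrite -[X in p X]li0.
    exact: (cvg_comp _ _ (@cvg_harmonic R) (pc t)).
  - exact: ic.
  - apply: aeW => t n; rewrite in_Rpos => t0; rewrite lee_fin.
    apply: le_trans (ple _) _; rewrite cmod_laplace_integrand// expr0 mulr1.
    rewrite -[leRHS]mulr1; apply: ler_wpM2l; first exact: cmod_ge0.
    by rewrite expR_le1 oppr_le0 !mulr_ge0 ?(ltW c0) ?(ltW t0).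
  move=> iL _ cL.
  have := fine_cvg (_ : (fun n => \int[mu]_(t in Rpos)
     (p (laplace_integrand v c 0 n.+1%:R^-1 t))%:E)%E @ \oo -->
     (\int[mu]_(t in Rpos) p (v t))%:E).
  apply; rewrite fineK//; apply: integrable_fin_num iL; exact: measurable_Rpos.
have cs t : cderiv (fun s => laplace_integrand v c 0 s t) 0
    (v t * (- (c * t%:C)) ^+ 0 * (- (c * t%:C) * 1%:C * cexp (- (c * t%:C) * 0%:C))).
  have di : cderiv (fun x : R => x%:C) (0 : R) 1%:C.
    exact: (@cderiv_real R id 0 1 (is_derive_id _ _)).
  exact: (cderivZ _ (cderiv_cexp (cderivZ (- (c * t%:C)) di))).
split; apply: main.
- by move=> n; exact: (laplace_integrand_measurable 0 n.+1%:R^-1).1.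
- exact: mv.1.
- exact: ler_Re_cmod.
- by move=> t; exact: is_derive_continuous (cs t).1.
- by move=> n; exact: (laplace_integrand_measurable 0 n.+1%:R^-1).2.
- exact: mv.2.
- exact: ler_Im_cmod.
- by move=> t; exact: is_derive_continuous (cs t).2.
Qed.

End Integrand.

(** The differences of the j-th derivatives of the two sides satisfy the
    bounds of [vanishing_continuation] with rho = Re c, since Re c <= 1.
    Hence the sides agree for all s > 0, and dominated convergence along
    s = 1 / (n + 1) gives s = 0. *)
Lemma laplace_continuation u v c (S : R) : cintegrable u -> cintegrable v ->
  0 < complex.Re c -> cmod c <= 1 -> 0 < S ->
  (forall s, S < s ->
    cintegral (fun t => u t * cexp (- (t%:C) * s%:C)) =
    cintegral (fun t => v t * cexp (- (c * t%:C) * s%:C))) ->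
  cintegral u = cintegral v.
Proof.
move=> iu iv c0 c1 S0 uv.
have o0 : 0 < complex.Re (1 : R[i]) by [].
have o1 : cmod (1 : R[i]) <= 1.
  by rewrite -[1 in X in cmod X]/(1%:C) cmod_real normr1.
set rho := complex.Re c.
have rho1 : rho <= 1 by rewrite (le_trans _ c1)// (le_trans (ler_norm _))// ler_Re_cmod.
pose Ku := \int[mu]_(t in Rpos) cmod (u t).
pose Kv := \int[mu]_(t in Rpos) cmod (v t).
have Ku0 : 0 <= Ku by apply: Rintegral_ge0 => t _; exact: cmod_ge0.
have uv0 s : S < s -> cintegral (laplace_integrand u 1 0 s) =
    cintegral (laplace_integrand v c 0 s).
  move=> Ss; have := uv s Ss; congr (_ = _); apply: eq_cintegral => t _.
    by rewrite /laplace_integrand expr0 mulr1 mul1r.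
  by rewrite /laplace_integrand expr0 mulr1.
have bnd j s : 0 < s -> (Ku * j`!%:R / (complex.Re (1 : R[i]) * s) ^+ j) +
    Kv * j`!%:R / (rho * s) ^+ j <= (Ku + Kv) * j`!%:R / (rho * s) ^+ j.
  move=> s0; rewrite (mulrDl Ku Kv) mulrDl lerD2r.
  apply: ler_wpM2l; first by rewrite mulr_ge0.
  rewrite lef_pV2 ?posrE ?exprn_gt0 ?mulr_gt0//.
  by apply: lerXn2r; rewrite ?nnegrE ?mulr_ge0 ?(ltW c0) ?(ltW s0)//= ler_wpM2r// ltW.
have main (p : R[i] -> R) :
    (forall j s, 0 < s -> is_derive s 1 (fun s =>
      p (cintegral (laplace_integrand u 1 j s)) -
      p (cintegral (laplace_integrand v c j s)))
      (p (cintegral (laplace_integrand u 1 j.+1 s)) -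
       p (cintegral (laplace_integrand v c j.+1 s)))) ->
    (forall j s, 0 < s -> `|p (cintegral (laplace_integrand u 1 j s))| <=
      Ku * j`!%:R / (complex.Re (1 : R[i]) * s) ^+ j) ->
    (forall j s, 0 < s -> `|p (cintegral (laplace_integrand v c j s))| <=
      Kv * j`!%:R / (rho * s) ^+ j) ->
    (fun n => p (cintegral (laplace_integrand u 1 0 n.+1%:R^-1))) @ \oo -->
      p (cintegral u) ->
    (fun n => p (cintegral (laplace_integrand v c 0 n.+1%:R^-1))) @ \oo -->
      p (cintegral v) -> p (cintegral u) = p (cintegral v).
  move=> dp bu bv cu cv.
  have H := @vanishing_continuation _ (fun j s =>
      p (cintegral (laplace_integrand u 1 j s)) -
      p (cintegral (laplace_integrand v c j s))) (Ku + Kv) rho c0 dp.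
  have {}H s : 0 < s -> p (cintegral (laplace_integrand u 1 0 s)) =
      p (cintegral (laplace_integrand v c 0 s)).
    move=> s0; apply/eqP; rewrite -subr_eq0; apply/eqP.
    apply: (H _ S) => // [j r r0|r Sr]; last by rewrite uv0// subrr.
    apply: le_trans (bnd j r r0); apply: le_trans (ler_normB _ _) _.
    by apply: lerD; [exact: bu|exact: bv].
  apply: (cvg_unique _ cu _) => //; apply: cvg_trans cv; apply: near_eq_cvg.
  by apply: nearW => n; rewrite H ?invr_gt0.
have eRe : complex.Re (cintegral u) = complex.Re (cintegral v).
  apply: (main (@complex.Re R)).
  - move=> j s s0; apply: is_deriveB.
      exact: (laplace_integrand_derive iu o0 o1 j s0).1.
    exact: (laplace_integrand_derive iv c0 c1 j s0).1.
  - by move=> j s s0; exact: (laplace_integrand_bound iu o0 o1 j s0).1.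
  - by move=> j s s0; exact: (laplace_integrand_bound iv c0 c1 j s0).1.
  - exact: (cvg_laplace_integrand0 iu o0).1.
  - exact: (cvg_laplace_integrand0 iv c0).1.
have eIm : complex.Im (cintegral u) = complex.Im (cintegral v).
  apply: (main (@complex.Im R)).
  - move=> j s s0; apply: is_deriveB.
      exact: (laplace_integrand_derive iu o0 o1 j s0).2.
    exact: (laplace_integrand_derive iv c0 c1 j s0).2.
  - by move=> j s s0; exact: (laplace_integrand_bound iu o0 o1 j s0).2.
  - by move=> j s s0; exact: (laplace_integrand_bound iv c0 c1 j s0).2.
  - exact: (cvg_laplace_integrand0 iu o0).2.
  - exact: (cvg_laplace_integrand0 iv c0).2.
by apply/eqP; rewrite eq_complex eRe eIm !eqxx.
Qed.

End LaplaceContinuation.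

(** * The Laplace transform of D1 *)

Section AppellTerms.
Variable R : realType.
Implicit Types (z w q u v x y : R[i]) (s t : R).

Local Opaque cexp cmod cgamma clog.

Lemma sqbounded_eq (a b : nat -> nat -> R) : (forall m n, a m n = b m n) ->
  sqbounded b -> sqbounded a.
Proof. by move=> ab; apply: sqbounded_le => m n; rewrite ab. Qed.

Variables (g1 : R[i]) (a1 b1 : R) (g2 : R[i]) (a2 : R) (g3 : R[i]) (b2 : R).
Variables (d1 : R[i]) (a3 b3 : R) (d2 : R[i]) (a4 : R) (d3 : R[i]) (b4 : R).
Local Notation E11t := (E11_term g1 a1 b1 g2 a2 g3 b2 d2 a4 d3 b4).
Local Notation D1t := (D1_term g1 a1 b1 g2 a2 g3 b2 d1 a3 b3 d2 a4 d3 b4).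

(** The exponent of t in the term of index (m, n) of D1 at
    (x t^a3, y t^b3). *)
Definition Dexponent (m n : nat) : R := a3 * m%:R + b3 * n%:R.
Local Notation e := Dexponent.

Lemma Dexponent_ge0 : 0 < a3 -> 0 < b3 -> forall m n, 0 <= e m n.
Proof. by move=> a30 b30 m n; rewrite addr_ge0// mulr_ge0// ltW. Qed.

Lemma D1_termE x y m n :
  D1t x y m n = E11t x y m n / cgamma (d1 + (e m n)%:C).
Proof.
rewrite /D1_term /E11_term -/(e m n).
by rewrite -!mulrA; do 3 congr (_ * _); rewrite mulrC -!mulrA.
Qed.

Lemma E11_term_scale x y u v m n :
  E11t (x * u) (y * v) m n = E11t x y m n * (u ^+ m * v ^+ n).
Proof. by rewrite /E11_term !exprMn; ring. Qed.

Lemma cpow_monomial q m n :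
  cpow q a3%:C ^+ m * cpow q b3%:C ^+ n = cexp ((e m n)%:C * clog q).
Proof.
rewrite /cpow !cexpMn -cexpD; congr cexp.
by rewrite /Dexponent rmorphD !rmorphM !rmorph_nat; ring.
Qed.

Lemma E11_term_cpow x y q m n :
  E11t (x / cpow q a3%:C) (y / cpow q b3%:C) m n =
  E11t x y m n * cexp (- ((e m n)%:C * clog q)).
Proof.
rewrite E11_term_scale; congr (_ * _).
by rewrite !exprVn -invfM cpow_monomial cexpN.
Qed.

Lemma D1_term_cpow x y t m n : 0 < t ->
  D1t (x * cpow t%:C a3%:C) (y * cpow t%:C b3%:C) m n =
  E11t x y m n / cgamma (d1 + (e m n)%:C) * cexp ((e m n)%:C * (ln t)%:C).
Proof.
move=> t0; rewrite D1_termE E11_term_scale cpow_monomial clog_real//.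
by rewrite mulrAC.
Qed.

Lemma D1_region_sqbounded x y t : 0 < t ->
  D1_region g1 a1 b1 g2 a2 g3 b2 d1 a3 b3 d2 a4 d3 b4
    (x * cpow t%:C a3%:C) (y * cpow t%:C b3%:C) ->
  sqbounded (fun m n =>
    cmod (E11t x y m n / cgamma (d1 + (e m n)%:C)) * expR (e m n * ln t)).
Proof.
move=> t0 /abs_convergent_sqbounded; apply: sqbounded_eq => m n.
by rewrite D1_term_cpow// [RHS]cmodM cmod_cexp Re_mulc /= mulr0 subr0.
Qed.

Lemma E11_region_sqbounded x y q :
  E11_region g1 a1 b1 g2 a2 g3 b2 d2 a4 d3 b4
    (x / cpow q a3%:C) (y / cpow q b3%:C) ->
  sqbounded (fun m n => cmod (E11t x y m n) * expR (- (e m n * ln (cmod q)))).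
Proof.
move=> /abs_convergent_sqbounded; apply: sqbounded_eq => m n.
rewrite E11_term_cpow [RHS]cmodM cmod_cexp Re_oppc Re_mulc /= mul0r subr0.
by [].
Qed.

End AppellTerms.

Local Opaque cexp cmod cgamma clog.

Theorem mainTheorem12 (R : realType)
    (g1 g2 g3 d1 d2 d3 x y p : R[i])
    (a1 a2 a3 a4 b1 b2 b3 b4 : R)
    (a1_gt0 : 0 < a1) (a2_gt0 : 0 < a2) (a3_gt0 : 0 < a3) (a4_gt0 : 0 < a4)
    (b1_gt0 : 0 < b1) (b2_gt0 : 0 < b2) (b3_gt0 : 0 < b3) (b4_gt0 : 0 < b4)
    (Re_d1_gt0 : 0 < complex.Re d1) (Re_p_gt0 : 0 < complex.Re p)
    (D1_conv : forall t : R, 0 < t ->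
       D1_region g1 a1 b1 g2 a2 g3 b2 d1 a3 b3 d2 a4 d3 b4
         (x * cpow t%:C a3%:C) (y * cpow t%:C b3%:C))
    (E11_conv :
       E11_region g1 a1 b1 g2 a2 g3 b2 d2 a4 d3 b4
         (x / cpow p a3%:C) (y / cpow p b3%:C)) :
  let f (t : R) : R[i] :=
    cpow t%:C (d1 - 1) *
    D1 g1 a1 b1 g2 a2 g3 b2 d1 a3 b3 d2 a4 d3 b4
      (x * cpow t%:C a3%:C) (y * cpow t%:C b3%:C) in
  (E11_region g1 a1 b1 g2 a2 g3 b2 d2 a4 d3 b4
     (x / cpow (complex.Re p)%:C a3%:C) (y / cpow (complex.Re p)%:C b3%:C) ->
   laplace_exists f p) /\
  (laplace_exists f p ->
   laplace f p =
     1 / cpow p d1 *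
     E11 g1 a1 b1 g2 a2 g3 b2 d2 a4 d3 b4
       (x / cpow p a3%:C) (y / cpow p b3%:C)).
Proof.
move=> f.
pose A := E11_term g1 a1 b1 g2 a2 g3 b2 d2 a4 d3 b4 x y.
pose e := Dexponent a3 b3.
have e0 : forall m n, 0 <= e m n by exact: Dexponent_ge0.
have bD t : 0 < t -> sqbounded (fun m n =>
    cmod (A m n / cgamma (d1 + (e m n)%:C)) * expR (e m n * ln t)).
  by move=> t0; exact: D1_region_sqbounded (D1_conv t t0).
pose h t := double_series (fun m n => A m n / cgamma (d1 + (e m n)%:C) *
    cexp ((d1 + (e m n)%:C - 1) * (ln t)%:C)).
have fh t : 0 < t -> f t = h t.
  move=> t0; rewrite /f /D1 -double_seriesZ.
    apply: eq_double_series => m n.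
    rewrite D1_term_cpow// cpow_real// mulrCA -cexpD.
    by congr (_ * cexp _); rewrite -mulrDl addrAC.
  exact: abs_convergent_sqbounded (D1_conv t t0).
have fhk q t : 0 < t -> laplace_kernel h q t = laplace_kernel f q t.
  by move=> t0; rewrite /laplace_kernel fh.
(* valid wherever the E11 series converges absolutely at Re q *)
have laplace_f q : 0 < complex.Re q ->
    sqbounded (fun m n => cmod (A m n) * expR (- (e m n * ln (complex.Re q)))) ->
    laplace_exists f q /\ laplace f q =
      double_series (fun m n => A m n * cexp (- ((d1 + (e m n)%:C) * clog q))).
  move=> q0 bq; have [h1 h2] := laplace_termwise Re_d1_gt0 e0 q0 bD bq.
  split; first exact: eq_cintegrable (fhk q) h1.
  by rewrite -h2; apply: eq_cintegral => t t0; rewrite fhk.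
split.
  move=> /E11_region_sqbounded; rewrite cmod_real ger0_norm ?(ltW Re_p_gt0)//.
  by move=> bq; have [] := laplace_f p Re_p_gt0 bq.
move=> fp.
have bE := E11_region_sqbounded E11_conv; rewrite -/A -/e in bE.
have m0 : 0 < cmod p.
  by rewrite (lt_le_trans Re_p_gt0)// (le_trans (ler_norm _))// ler_Re_cmod.
have bE' r : cmod p <= r ->
    sqbounded (fun m n => cmod (A m n) * expR (- (e m n * ln r))).
  move=> pr; apply: sqbounded_le bE => m n; apply: ler_wpM2l; first exact: cmod_ge0.
  by rewrite ler_expR lerN2 ler_wpM2l// ler_ln ?posrE// (lt_le_trans m0).
(* c = e^(-i th) turns p to the positive real axis *)
have [pE pI] := clog_right Re_p_gt0; set th := complex.Im (clog p) in pI.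
have ReP : complex.Re (clog p) = ln (cmod p) by [].
pose c : R[i] := cexp (0 +i* - th).
have clogp : clog p = ln (cmod p) +i* th by rewrite -ReP /th; case: (clog p).
have pi0 := @pi_gt0 R.
have /andP[th1 th2] : - (pi / 2) < th < pi / 2 by rewrite -ltr_norml.
have cRe : complex.Re c = cos th by rewrite /c cexp_def expR0 mul1r /= cosN.
have c0 : 0 < complex.Re c by rewrite cRe cos_gt0_pihalf// th1.
have c1 : cmod c <= 1 by rewrite cmod_cexp expR0.
have cp : c * p = (cmod p)%:C.
  rewrite /c -[in LHS]pE -cexpD clogp.
  have -> : 0 +i* - th + (ln (cmod p) +i* th) = (ln (cmod p))%:C.
    by apply/eqP; rewrite eq_complex /= add0r addNr !eqxx.
  by rewrite cexp_real lnK.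
(* the coefficients of h', the expansion on the rotated half-line *)
pose A' m n := A m n * cexp ((0 +i* - th) * (d1 + (e m n)%:C)).
have cA' m n : cmod (A' m n) = expR (th * complex.Im d1) * cmod (A m n).
  rewrite cmodM cmod_cexp mulrC; congr (expR _ * _).
  by rewrite Re_mulc Im_addc /= addr0 mul0r sub0r mulNr opprK.
have bD' t : 0 < t -> sqbounded (fun m n =>
    cmod (A' m n / cgamma (d1 + (e m n)%:C)) * expR (e m n * ln t)).
  move=> t0; have := sqboundedZ (expR_ge0 (th * complex.Im d1)) (bD t t0).
  by apply: sqbounded_eq => m n; rewrite cmodM (cmodM (A m n)) cA' !mulrA.
have bA' r : cmod p <= r ->
    sqbounded (fun m n => cmod (A' m n) * expR (- (e m n * ln r))).
  move=> /bE' /(sqboundedZ (expR_ge0 (th * complex.Im d1))).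
  by apply: sqbounded_eq => m n; rewrite cA' mulrA.
pose h' t := double_series (fun m n => A' m n / cgamma (d1 + (e m n)%:C) *
    cexp ((d1 + (e m n)%:C - 1) * (ln t)%:C)).
have laplace_h' q : cmod p <= complex.Re q -> laplace_exists h' q /\ laplace h' q =
    double_series (fun m n => A m n *
      cexp (- ((d1 + (e m n)%:C) * (clog q + (0 +i* th))))).
  move=> q0; have qq := lt_le_trans m0 q0.
  have [k1 k2] := laplace_termwise Re_d1_gt0 e0 qq bD' (bA' _ q0).
  split => //; rewrite k2; apply: eq_double_series => m n.
  rewrite /A' -mulrA -cexpD; congr (_ * cexp _).
  have -> : 0 +i* - th = - (0 +i* th) :> R[i].
    by apply/eqP; rewrite eq_complex /= oppr0 !eqxx.
  by ring.
(* at s = 0 the rotated integral already has the required value; it remains to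
   identify it with the Laplace integral of f at p *)
have [vi vE] := laplace_h' (cmod p)%:C (lexx _).
have -> : laplace f p = laplace h' (cmod p)%:C.
  apply: (@laplace_continuation _ _ _ c (cmod p)) => // s ps.
  have s0 : 0 < s := lt_trans m0 ps.
  transitivity (laplace f (p + s%:C)).
    apply: eq_cintegral => t _; rewrite /laplace_kernel -mulrA -cexpD.
    by congr (_ * cexp _); ring.
  transitivity (laplace h' ((cmod p)%:C + c * s%:C)); last first.
    apply: eq_cintegral => t _; rewrite /laplace_kernel -mulrA -cexpD.
    by congr (_ * cexp _); ring.
  have Reps : complex.Re (p + s%:C) = complex.Re p + s by rewrite Re_addc.
  have psp : cmod p <= complex.Re (p + s%:C) by rewrite Reps; lra.
  have [_ ->] := laplace_f (p + s%:C) (lt_le_trans m0 psp) (bE' _ psp).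
  have Recs : complex.Re ((cmod p)%:C + c * s%:C) = cmod p + complex.Re c * s.
    by rewrite Re_addc Re_mulc /= mulr0 subr0.
  have csp : cmod p <= complex.Re ((cmod p)%:C + c * s%:C).
    by rewrite Recs lerDl mulr_ge0 ?ltW.
  have [_ ->] := laplace_h' _ csp.
  have [qE qI] := clog_right (lt_le_trans m0 csp).
  set q := (cmod p)%:C + c * s%:C in qE qI *.
  (* both arguments are smaller than pi / 2, so no multiple of 2 pi appears *)
  have -> : clog (p + s%:C) = clog q + (0 +i* th) => //.
  rewrite -[RHS]clog_cexp.
    rewrite cexpD qE /q -cp -mulrDr mulrAC /c -cexpD.
    have -> : 0 +i* - th + 0 +i* th = 0 :> R[i].
      by apply/eqP; rewrite eq_complex /= addr0 addNr !eqxx.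
    by rewrite cexp0 mul1r.
  rewrite Im_addc /= (le_lt_trans (ler_normD _ _))//.
  by move: pI qI; lra.
rewrite vE clog_real// /E11.
have clp : (ln (cmod p))%:C + (0 +i* th) = clog p.
  by rewrite clogp; apply/eqP; rewrite eq_complex /= addr0 add0r !eqxx.
rewrite clp -double_seriesZ; last exact: abs_convergent_sqbounded E11_conv.
apply: eq_double_series => m n.
rewrite E11_term_cpow [RHS]mulrCA; congr (_ * _).
rewrite mul1r /cpow -cexpN.
rewrite -cexpD; congr cexp; rewrite /e; ring.
Qed.
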